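(* Let $\xi=(\xi_t)_{t\in\mathbb R}$ be a process with stationary noncorrelated increments, invariant with respect to a strongly continuous group of unitaries $U=(U_t)_{t\in\mathbb R}$ in the Hilbert space $H$, and let $V=(V_t)_{t\ge0}$, $V_t=U_{-t}|_{H^\xi_{0]}}$, be the corresponding semigroup of completely nonunitary isometrical operators in $H^\xi_{0]}$. Let $W=(W_t)_{t\in\mathbb R}$ be a Markovian $U$-cocycle. Then $W$ determines a semigroup of isometrical operators $\tilde V=(W_{-t}V_t)_{t\in\mathbb R_+}$ in $H^\xi_{0]}$ with unit index. The Wold decomposition $H^\xi_{0]}=H^{(1)}\oplus H^{(2)}$ associated with the semigroup $\tilde V$ is given by the condition $$H^{(2)}=W_{-\infty}H^\xi_{0]},\qquad W_{-\infty}=s\text{-}\lim_{t\to+\infty}W_{-t}.$$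
   Context: Random variables with finite second moments on a probability space are identified with elements of the Hilbert space $H$ with inner product $(\xi,\eta)=\mathbb E(\xi\overline\eta)$; a process is a continuous curve $(\xi_t)_{t\in\mathbb R}$ in $H$ with $\xi_0=0$. $H^\xi\subset H$ is the closed subspace generated by all increments $\xi_s-\xi_r$ (in general $H^\xi\ne H$); $H^\xi_{t]}$ (past) is generated by $\xi_s-\xi_r$ with $s,r\le t$, and $H^\xi_{[t}$ (future) by $\xi_s-\xi_r$ with $s,r\ge t$. $\xi$ is invariant with respect to $U$ if $\xi_{t+s}=\xi_t+U_t\xi_s$ for all $s,t\in\mathbb R$. Increments are noncorrelated if $\xi_{t_1}-\xi_{s_1}\perp\xi_{t_2}-\xi_{s_2}$ for all disjoint intervals $(s_1,t_1)$, $(s_2,t_2)$. A $U$-cocycle is a strongly continuous family of unitaries $W=(W_t)_{t\in\mathbb R}$ in $H$ with $W_0=I$ and $W_{t+s}=W_tU_tW_sU_t^*$ for $s,t\in\mathbb R$; it is Markovian if $W_tf=f$ for $f\in H^\xi_{[t}$, $t>0$. The index of a strongly continuous semigroup of isometries is the deficiency index of its generator $d$, i.e. the number of linearly independent solutions of $d^*f=-f$. The Wold decomposition of a Hilbert space associated with a strongly continuous semigroup of isometries is the orthogonal decomposition into subspaces $H^{(1)}$ and $H^{(2)}$ reducing the semigroup to a semigroup of unitary operators and to a semigroup of completely nonunitary isometrical operators, respectively; completely nonunitary means that there is no subspace reducing to a unitary operator.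
   Formalization: The process is assumed not identically zero, each W_t is assumed to map H^ξ into itself (without this the claim fails when H^ξ ≠ H), and the strong limit of W_{-t} is asserted on H^ξ only, since on all of H it need not exist. *)

(* Defs.v *)
From mathcomp Require Import all_boot all_order all_algebra.
From mathcomp Require Import all_classical all_reals all_analysis complex.

Set Implicit Arguments.
Unset Strict Implicit.
Unset Printing Implicit Defensive.

Import Order.TTheory GRing.Theory Num.Theory numFieldNormedType.Exports.

Local Open Scope classical_set_scope.
Local Open Scope complex_scope.
Local Open Scope ring_scope.

(* A complex Hilbert space is a complete normed space H over R[i] together with
   a positive definite Hermitian form dot, linear in its first argument and
   antilinear in the second, as E(xi * conj eta), that induces the norm. *)
Definition hilbert_form (R : realType) (H : completeNormedModType R[i])
    (dot : {dot H for Num.conj}) : Prop :=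
  forall f : H, `|f| ^+ 2 = dot f f.

Section Subspaces.
Context {R : realType} {H : completeNormedModType R[i]}.
Variable dot : {dot H for Num.conj}.
Implicit Types K L M : set H.

Definition closed_subspace M : Prop :=
  [/\ closed M, M 0
    & forall (a : R[i]) (f g : H), M f -> M g -> M (a *: f + g)].

Definition closed_span (A : set H) : set H := smallest closed_subspace A.

Definition orthogonal_sets L M : Prop :=
  forall f g : H, L f -> M g -> dot f g = 0.

(* orthogonal complement of M inside K *)
Definition ocompl K M : set H :=
  [set f | K f /\ forall g : H, M g -> dot f g = 0].

Definition orthogonal_sum K L M : Prop :=
  orthogonal_sets L M /\ K = [set f + g | f in L & g in M].

(* M is an n-dimensional linear space: it has a basis of n vectors *)
Definition has_dimension M (n : nat) : Prop :=
  exists e : 'I_n -> H,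
    [/\ forall i, M (e i),
        forall c : 'I_n -> R[i], \sum_(i < n) c i *: e i = 0 -> forall i, c i = 0
      & forall f, M f -> exists c : 'I_n -> R[i], f = \sum_(i < n) c i *: e i].

End Subspaces.

Section Operators.
Context {R : realType} {H : completeNormedModType R[i]}.
Variable dot : {dot H for Num.conj}.

(* The adjoint of an everywhere defined operator. The vector z is unique when
   it exists, and it exists for all y when A is bounded (Riesz). *)
Definition adjoint (A : H -> H) (y : H) : H :=
  xget 0 [set z | forall x, dot (A x) y = dot x z].

Definition unitary (A : {linear H -> H}) : Prop :=
  isometry dot dot A /\ set_surj setT setT A.

Definition strongly_continuous (A : R -> H -> H) : Prop :=
  forall f : H, continuous (fun t => A t f).

Definition unitary_group (U : R -> {linear H -> H}) : Prop :=
  [/\ forall t, unitary (U t), forall f, U 0 f = f,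
      forall s t f, U (s + t) f = U s (U t f) & strongly_continuous U].

Definition cocycle (U W : R -> {linear H -> H}) : Prop :=
  [/\ forall t, unitary (W t), strongly_continuous W, forall f, W 0 f = f
    & forall s t f, W (t + s) f = W t (U t (W s (adjoint (U t) f)))].

End Operators.

Section Processes.
Context {R : realType} {H : completeNormedModType R[i]}.
Variable dot : {dot H for Num.conj}.
Variable xi : R -> H.

Definition process : Prop := continuous xi /\ xi 0 = 0.

Definition increments (D : set R) : set H := [set xi s - xi r | s in D & r in D].

Definition increments_space : set H := closed_span (increments setT).

Definition past (t : R) : set H := closed_span (increments `]-oo, t]%classic).

Definition future (t : R) : set H := closed_span (increments `[t, +oo[%classic).

(* second-order stationarity *)
Definition stationary_increments : Prop :=
  forall t s1 r1 s2 r2 : R,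
    dot (xi (s1 + t) - xi (r1 + t)) (xi (s2 + t) - xi (r2 + t)) =
    dot (xi s1 - xi r1) (xi s2 - xi r2).

Definition noncorrelated_increments : Prop :=
  forall s1 t1 s2 t2 : R, s1 < t1 -> s2 < t2 ->
    `]s1, t1[%classic `&` `]s2, t2[%classic = set0 ->
    dot (xi t1 - xi s1) (xi t2 - xi s2) = 0.

Definition invariant_process (U : R -> {linear H -> H}) : Prop :=
  forall s t : R, xi (t + s) = xi t + U t (xi s).

Definition markovian (W : R -> {linear H -> H}) : Prop :=
  forall t f, 0 < t -> future t f -> W t f = f.

End Processes.

(* A semigroup of operators in a closed subspace K is a family S defined on all
   of H, of which only the values S t f with 0 <= t and f in K are used. *)
Section Semigroups.
Context {R : realType} {H : completeNormedModType R[i]}.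
Variable dot : {dot H for Num.conj}.
Implicit Types (K L M : set H) (S : R -> H -> H).

Record isometric_semigroup K S : Prop := IsometricSemigroup {
  isg_stable : forall t f, 0 <= t -> K f -> K (S t f);
  isg_linear : forall t (a : R[i]) f g, 0 <= t -> K f -> K g ->
    S t (a *: f + g) = a *: S t f + S t g;
  isg_isometric : forall t f g, 0 <= t -> K f -> K g ->
    dot (S t f) (S t g) = dot f g;
  isg_zero : forall f, K f -> S 0 f = f;
  isg_add : forall s t f, 0 <= s -> 0 <= t -> K f -> S (s + t) f = S s (S t f);
  isg_continuous : forall f, K f ->
    {within `[0, +oo[%classic, continuous (fun t => S t f)}
}.

(* graph of the generator d of S: f is in the domain of d and d f = g *)
Definition generator K S (f g : H) : Prop :=
  K f /\ ((t^-1)%:C *: (S t f - f)) @[t --> 0^'+] --> g.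

(* graph of the adjoint, in K, of the (possibly unbounded) operator in K with
   graph d *)
Definition adjoint_graph K (d : H -> H -> Prop) (f g : H) : Prop :=
  [/\ K f, K g & forall x y, d x y -> dot y f = dot x g].

(* the space of the solutions of d^* f = - f has dimension n *)
Definition has_index K S (n : nat) : Prop :=
  has_dimension [set f | adjoint_graph K (generator K S) f (- f)] n.

Definition reducing K S M : Prop :=
  [/\ closed_subspace M, M `<=` K,
      forall t f, 0 <= t -> M f -> M (S t f)
    & forall t f, 0 <= t -> ocompl dot K M f -> ocompl dot K M (S t f)].

Definition unitary_on M S : Prop :=
  forall t, 0 <= t ->
    (forall f g, M f -> M g -> dot (S t f) (S t g) = dot f g) /\
    S t @` M = M.

Definition completely_nonunitary K S : Prop :=
  forall L, reducing K S L -> unitary_on L S -> L = [set 0].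

Definition wold_decomposition K S H1 H2 : Prop :=
  [/\ orthogonal_sum dot K H1 H2, reducing K S H1, reducing K S H2,
      unitary_on H1 S & completely_nonunitary H2 S].

End Semigroups.

(* W_{-oo} f; a junk value when W (- t) f has no limit *)
Definition minus_infinity_limit (R : realType) (H : completeNormedModType R[i])
    (W : R -> {linear H -> H}) (f : H) : H :=
  lim (W (- t) f @[t --> +oo]).

(* Main.v *)
Require Import Defs.
From mathcomp Require Import all_boot all_order all_algebra.
From mathcomp Require Import all_classical all_reals all_analysis complex.
From mathcomp Require Import ring lra.

Set Implicit Arguments.
Unset Strict Implicit.
Unset Printing Implicit Defensive.

Import Order.TTheory GRing.Theory Num.Theory numFieldNormedType.Exports.
Local Open Scope classical_set_scope.
Local Open Scope complex_scope.
Local Open Scope ring_scope.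

(* The perturbed semigroup [tV t = W (- t) U (- t)] is again built from a unitary
   group. By the Markov property [W (- t)] fixes the future of [0], hence it
   maps the past [K] to itself, and [W (- t) f] does not depend on [t >= r] for
   [f] in the future of [- r]; so [Winf = lim W (- t)] exists on the closed span
   of the increments, is isometric there and intertwines [V] with [tV]. Moreover
   the complement of [tV t K] in [K] is spanned by the images under [Winf] of the
   increments between [- t] and [0], so the intersection of the [tV t K] is the
   orthogonal complement of [Winf K] in [K]: this is the unitary part.

   For the index, [d^* f = - f] means [(S t x, f) = e^-t (x, f)] for all [t >= 0]
   and [x] in [K], because the integrals of [s |-> S s x] over [[0, h]] lie in the
   domain of [d]. Such [f] are orthogonal to the unitary part, which reduces the
   count to [V]; for [V] they are the multiples of the stochastic integral of
   [e^-s] against [xi (- s)], equal by parts to the limit as [T] tends to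
   infinity of the integral of [e^-s xi (- s)] over [[0, T]]. *)

(** * Real inner product and norm *)

Section RealDot.
Context {R : realType} {H : completeNormedModType R[i]}.
Context (dot : {dot H for Num.conj}).

(** Inner products and norms of [H] lie in [R[i]]. Their real parts are used so that order and real
    derivatives apply; [dotE] returns to the complex form. *)
Definition rdot (f g : H) : R := complex.Re (dot f g).
Definition nrm (f : H) : R := complex.Re `|f|.

Lemma dot0l g : dot 0 g = 0. Proof. exact: linear0l. Qed.

Lemma dot0r f : dot f 0 = 0. Proof. exact: linear0r. Qed.

Lemma dotDl f g h : dot (f + g) h = dot f h + dot g h.
Proof. exact: linearDl. Qed.

Lemma dotDr f g h : dot h (f + g) = dot h f + dot h g.
Proof. exact: linearDr. Qed.

Lemma dotNl f h : dot (- f) h = - dot f h. Proof. exact: linearNl. Qed.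

Lemma dotNr f h : dot h (- f) = - dot h f. Proof. exact: linearNr. Qed.

Lemma dotBl f g h : dot (f - g) h = dot f h - dot g h.
Proof. by rewrite dotDl dotNl. Qed.

Lemma dotBr f g h : dot h (f - g) = dot h f - dot h g.
Proof. by rewrite dotDr dotNr. Qed.

Lemma dotZr a f h : dot h (a *: f) = Num.conj a * dot h f.
Proof. exact: linearZr_LR. Qed.

Lemma dot_conj f g : dot f g = Num.conj (dot g f).
Proof. by rewrite (hermC dot) expr0 mul1r. Qed.

Lemma rdotC f g : rdot f g = rdot g f.
Proof. by rewrite /rdot dot_conj; case: (dot g f). Qed.

Lemma rdotDl f g h : rdot (f + g) h = rdot f h + rdot g h.
Proof. by rewrite /rdot linearDl raddfD. Qed.

Lemma rdotNl f h : rdot (- f) h = - rdot f h.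
Proof. by rewrite /rdot linearNl raddfN. Qed.

Lemma rdotBl f g h : rdot (f - g) h = rdot f h - rdot g h.
Proof. by rewrite rdotDl rdotNl. Qed.

Lemma rdotZl (a : R) f h : rdot (a%:C *: f) h = a * rdot f h.
Proof.
rewrite /rdot linearZl_LR /=.
by case: (dot f h) => x y /=; rewrite mul0r subr0.
Qed.

Lemma rdot0l h : rdot 0 h = 0.
Proof. by rewrite /rdot linear0l. Qed.

Lemma rdotDr f g h : rdot h (f + g) = rdot h f + rdot h g.
Proof. by rewrite rdotC rdotDl !(rdotC h). Qed.

Lemma rdotNr f h : rdot h (- f) = - rdot h f.
Proof. by rewrite rdotC rdotNl (rdotC h). Qed.

Lemma rdotBr f g h : rdot h (f - g) = rdot h f - rdot h g.
Proof. by rewrite rdotDr rdotNr. Qed.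

Lemma rdotZr (a : R) f h : rdot h (a%:C *: f) = a * rdot h f.
Proof. by rewrite rdotC rdotZl (rdotC h). Qed.

Lemma rdot0r h : rdot h 0 = 0.
Proof. by rewrite rdotC rdot0l. Qed.

Lemma dotZir f g : dot f ('i%C *: g) = - 'i%C * dot f g.
Proof.
rewrite linearZr_LR /=; congr (_ * _).
by apply/eqP; rewrite eq_complex /= oppr0 !eqxx.
Qed.

(** Antilinearity in the second argument makes the imaginary part of [dot f g] the real part of
    [dot f (i g)]. A real identity for both [g] and [i g] is thus a complex one. *)
Lemma dotE f g : dot f g = rdot f g +i* rdot f ('i%C *: g).
Proof.
by rewrite /rdot dotZir; case: (dot f g) => a b /=; congr (_ +i* _); ring.
Qed.

Lemma nrmE f : `|f| = (nrm f)%:C.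
Proof. by rewrite /nrm RRe_real // normr_real. Qed.

Lemma nrm_ge0 f : 0 <= nrm f.
Proof. by rewrite -lecR -nrmE normr_ge0. Qed.

Lemma nrm_eq0 f : (nrm f == 0) = (f == 0).
Proof. by rewrite -(normr_eq0 f) nrmE eq_complex /= eqxx andbT. Qed.

Lemma nrm0 : nrm 0 = 0.
Proof. by apply/eqP; rewrite nrm_eq0. Qed.

Lemma nrmN f : nrm (- f) = nrm f.
Proof. by rewrite /nrm normrN. Qed.

Lemma nrmC f g : nrm (f - g) = nrm (g - f).
Proof. by rewrite -nrmN opprB. Qed.

Lemma nrmD f g : nrm (f + g) <= nrm f + nrm g.
Proof. by rewrite -lecR raddfD /= -!nrmE ler_normD. Qed.

Lemma nrm_distD h f g : nrm (f - g) <= nrm (f - h) + nrm (h - g).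
Proof. by rewrite -{1}(subrK h f) -addrA nrmD. Qed.

Lemma nrmZ (a : R[i]) f : nrm (a *: f) = complex.Re `|a| * nrm f.
Proof.
rewrite /nrm normrZ; have /RRe_real <- : `|a| \is Num.real by rewrite normr_real.
by rewrite (nrmE f) /= mulr0 subr0.
Qed.

Lemma nrmZr (a : R) f : nrm (a%:C *: f) = `|a| * nrm f.
Proof. by rewrite nrmZ normc_def /= expr0n addr0 sqrtr_sqr. Qed.

Section TopologyOfNorm.
Context {T : Type} (F : set_system T) {FF : Filter F}.

Lemma cvg_nrmP (u : T -> H) (l : H) :
  u x @[x --> F] --> l <->
  forall e : R, 0 < e -> \forall x \near F, nrm (l - u x) < e.
Proof.
split => [/cvgrPdist_lt ul e e0|ul].
  have e0' : 0 < e%:C by rewrite -(ltcR 0 e) in e0.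
  by near=> x; rewrite -ltcR -nrmE; near: x; exact: ul.
apply/cvgrPdist_lt => e e0.
have eE : e = (complex.Re e)%:C by rewrite RRe_real // gtr0_real.
rewrite eE; rewrite eE ltcR in e0.
by near=> x; rewrite nrmE ltcR; near: x; exact: ul.
Unshelve. all: by end_near. Qed.

End TopologyOfNorm.

Context (dotH : hilbert_form dot).

Lemma rdotff f : rdot f f = nrm f ^+ 2.
Proof. by rewrite /rdot -dotH nrmE -rmorphXn. Qed.

Lemma rdotff_ge0 f : 0 <= rdot f f.
Proof. by rewrite rdotff sqr_ge0. Qed.

Lemma rdotff_eq0 f : rdot f f = 0 -> f = 0.
Proof.
by rewrite rdotff => /eqP; rewrite sqrf_eq0 nrm_eq0 => /eqP.
Qed.

Lemma nrmB_sqr f g : nrm (f - g) ^+ 2 = nrm f ^+ 2 - 2 * rdot f g + nrm g ^+ 2.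
Proof.
rewrite -!rdotff rdotBl !rdotBr (rdotC g f); ring.
Qed.

Lemma ler_rdot f g : `|rdot f g| <= nrm f * nrm g.
Proof.
have [->|g0] := eqVneq g 0; first by rewrite rdot0r nrm0 normr0 mulr0.
have ng : 0 < nrm g by rewrite lt_neqAle nrm_ge0 andbT eq_sym nrm_eq0.
rewrite -(@ler_pXn2r _ 2) ?nnegrE ?normr_ge0 ?mulr_ge0 ?nrm_ge0 // real_normK ?num_real //.
have := rdotff_ge0 ((nrm g ^+ 2)%:C *: f - (rdot f g)%:C *: g).
rewrite rdotBl !rdotBr !rdotZl !rdotZr (rdotC g f) !rdotff => h.
rewrite -(@ler_pM2l _ (nrm g ^+ 2)) ?exprn_gt0 //; lra.
Qed.

Lemma dot_eq0P f g : rdot f g = 0 -> rdot f ('i%C *: g) = 0 -> dot f g = 0.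
Proof. by rewrite dotE => -> ->. Qed.

Lemma rdot_cvg {T : Type} (F : set_system T) {FF : Filter F} (u : T -> H) l g :
  u x @[x --> F] --> l -> rdot (u x) g @[x --> F] --> rdot l g.
Proof.
move=> /cvg_nrmP ul; apply/cvgrPdist_lt => e e0.
have c0 : 0 < nrm g + 1 by rewrite ltr_wpDl // nrm_ge0.
near=> x; rewrite -rdotBl.
apply: (le_lt_trans (ler_rdot _ _)).
apply: (@le_lt_trans _ _ (nrm (l - u x) * (nrm g + 1))).
  by rewrite ler_wpM2l ?nrm_ge0 // lerDl.
by rewrite -ltr_pdivlMr //; near: x; apply: ul; rewrite divr_gt0.
Unshelve. all: by end_near. Qed.

Lemma nrm_cvg {T : Type} (F : set_system T) {FF : Filter F} (u : T -> H) l :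
  u x @[x --> F] --> l -> nrm (u x) @[x --> F] --> nrm l.
Proof.
move=> /cvg_nrmP ul; apply/cvgrPdist_lt => e e0.
near=> x; apply: (@le_lt_trans _ _ (nrm (l - u x))); last by near: x; exact: ul.
rewrite ler_norml; apply/andP; split.
  by rewrite lerBrDl lerBlDr nrmC -{1}(subrK l (u x)) addrC nrmD.
by rewrite lerBlDr -{1}(subrK (u x) l) nrmD.
Unshelve. all: by end_near. Qed.

End RealDot.

Lemma cvg_map_unique {R : numFieldType} {V : normedModType R} {T : Type}
    (F : set_system T) {FF : ProperFilter F} (u : T -> V) (l m : V) :
  u x @[x --> F] --> l -> u x @[x --> F] --> m -> l = m.
Proof. exact: norm_cvg_unique. Qed.

Lemma cvg_scale_real {R : realType} {H : completeNormedModType R[i]} {T : Type}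
    (F : set_system T) {FF : Filter F} (u : T -> R) (l : R) (f : T -> H) (g : H) :
  u x @[x --> F] --> l -> f x @[x --> F] --> g ->
  (u x)%:C *: f x @[x --> F] --> l%:C *: g.
Proof.
move=> /cvgrPdist_lt ul fg; apply: cvgZ => //; apply/cvgrPdist_lt => e e0.
have eE : e = (complex.Re e)%:C by rewrite RRe_real // gtr0_real.
rewrite eE in e0 *; rewrite ltcR in e0; near=> x.
rewrite -raddfB /= normc_def /= expr0n addr0 sqrtr_sqr ltcR.
by near: x; exact: ul.
Unshelve. all: by end_near. Qed.

(** * Closed subspaces and the Riesz representation *)

Section ClosedSubspaces.
Context {R : realType} {H : completeNormedModType R[i]}.
Context (dot : {dot H for Num.conj}) (dotH : hilbert_form dot).
Implicit Types M K : set H.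
Local Notation rdot := (rdot dot).

Lemma closed_nrm M f :
  closed M -> (forall e : R, 0 < e -> exists2 m, M m & nrm (f - m) < e) -> M f.
Proof.
move=> cM fM; apply: cM => B /nbhs_normP[e /= e0 eB].
have eE : e = (complex.Re e)%:C by rewrite RRe_real // gtr0_real.
rewrite eE ltcR in e0; have [m Mm fm] := fM _ e0.
by exists m; split => //; apply: eB => /=; rewrite nrmE eE ltcR.
Qed.

Lemma nrm_closed M :
  (forall f, (forall e : R, 0 < e -> exists2 m, M m & nrm (f - m) < e) -> M f) ->
  closed M.
Proof.
move=> hM f clf; apply: hM => e e0.
have e0' : 0 < e%:C by rewrite -(ltcR 0 e) in e0.
have [m [Mm /= fm]] := clf _ (nbhs_ball_norm f (PosNum e0')).
by exists m => //; rewrite -ltcR -nrmE.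
Qed.

Section Operations.
Context (M : set H) (sM : closed_subspace M).

Lemma subspace0 : M 0. Proof. by case: sM. Qed.

Lemma subspaceP (a : R[i]) f g : M f -> M g -> M (a *: f + g).
Proof. by case: sM => _ _; exact. Qed.

Lemma subspaceD f g : M f -> M g -> M (f + g).
Proof. by move=> Mf Mg; rewrite -(scale1r f); exact: subspaceP. Qed.

Lemma subspaceZ a f : M f -> M (a *: f).
Proof. by move=> Mf; rewrite -(addr0 (a *: f)); apply: subspaceP => //; exact: subspace0. Qed.

Lemma subspaceN f : M f -> M (- f).
Proof. by move=> Mf; rewrite -scaleN1r; exact: subspaceZ. Qed.

Lemma subspaceB f g : M f -> M g -> M (f - g).
Proof. by move=> Mf Mg; apply: subspaceD => //; exact: subspaceN. Qed.

Lemma subspace_nrm f :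
  (forall e : R, 0 < e -> exists2 m, M m & nrm (f - m) < e) -> M f.
Proof. by apply: closed_nrm; case: sM. Qed.

Lemma subspace_cvg {T : Type} (F : set_system T) {FF : ProperFilter F}
    (u : T -> H) l :
  (\forall x \near F, M (u x)) -> u x @[x --> F] --> l -> M l.
Proof. by move=> Mu; apply: closed_cvg => //; case: sM. Qed.

(** A complex subspace contains [i g] along with [g], so vanishing real parts suffice. *)
Lemma rdot_subspace f : (forall g, M g -> rdot f g = 0) ->
  forall g, M g -> dot f g = 0.
Proof.
by move=> fM g Mg; apply: dot_eq0P; apply: fM => //; exact: subspaceZ.
Qed.

End Operations.

Lemma closed_span_subspace (A : set H) : closed_subspace (closed_span A).
Proof.
split.
- apply: closed_bigI => M [] [] //.
- by move=> M [] [].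
- by move=> a f g Af Ag M [sM AM]; apply: subspaceP => //; [exact: Af|exact: Ag].
Qed.

Lemma sub_closed_span (A : set H) : A `<=` closed_span A.
Proof. by move=> f Af M [_]; exact. Qed.

Lemma closed_span_min (A : set H) M : closed_subspace M -> A `<=` M -> closed_span A `<=` M.
Proof. by move=> sM AM f; apply; split. Qed.

Lemma orthogonal_subspace (A : set H) :
  closed_subspace [set f | forall g, A g -> dot f g = 0].
Proof.
split.
- apply: nrm_closed => f fA g Ag.
  (* The second alternative is refuted for both [z = g] and [z = i g], so one Cauchy-Schwarz
     estimate serves both. *)
  suff fg0 z : rdot f z = 0 \/ ~ (forall m, (forall g, A g -> dot m g = 0) -> rdot m z = 0).
    by apply: dot_eq0P; [have [//|[]] := fg0 g|have [//|[]] := fg0 ('i%C *: g)];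
      move=> m /(_ g Ag) mg; rewrite /rdot ?dotZir mg ?mulr0.
  have [mz|] := pselect (forall m, (forall g, A g -> dot m g = 0) -> rdot m z = 0);
    last by right.
  left; apply/eqP/negPn/negP => fz.
  have nz : 0 < nrm z.
    rewrite lt_neqAle nrm_ge0 andbT eq_sym nrm_eq0; apply: contra_neq fz => ->.
    exact: rdot0r.
  have e0 : 0 < `|rdot f z| / nrm z by rewrite divr_gt0 ?normr_gt0.
  have [m Am] := fA _ e0.
  rewrite ltr_pdivlMr // ltNge => /negP; apply.
  by have := ler_rdot dotH (f - m) z; rewrite rdotBl (mz m) // subr0.
- by move=> g _; rewrite linear0l.
- by move=> a f g fA gA h Ah; rewrite linearPl /= fA // gA // mulr0 addr0.
Qed.

Lemma ocompl_subspace K M : closed_subspace K -> closed_subspace (ocompl dot K M).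
Proof.
move=> [cK K0 KP]; have [cM M0 MP] := orthogonal_subspace M.
split; [exact: closedI|by split|].
by move=> a f g [Kf Mf] [Kg Mg]; split; [exact: KP|exact: MP].
Qed.

Lemma preimage_subspace (A : {linear H -> H}) M :
  (forall f, nrm (A f) = nrm f) -> closed_subspace M ->
  closed_subspace (A @^-1` M).
Proof.
move=> nA sM; split.
- apply: nrm_closed => f fM; apply: (subspace_nrm sM) => e e0.
  by have [m Mm fm] := fM _ e0; exists (A m) => //; rewrite -raddfB nA.
- by rewrite /= raddf0; exact: (subspace0 sM).
- by move=> a f g /= Mf Mg; rewrite linearP; exact: (subspaceP sM).
Qed.

(* The minimizer of [|y|^2 - 2 p y] on [M]; minimizing sequences are Cauchy by
   the parallelogram law. *)
Lemma riesz M (p : H -> R) (C : R) : closed_subspace M ->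
  (forall f g, M f -> M g -> p (f + g) = p f + p g) ->
  (forall (a : R) f, M f -> p (a%:C *: f) = a * p f) ->
  (forall f, M f -> p f <= C * nrm f) ->
  exists2 z, M z & forall y, M y -> p y = rdot z y.
Proof.
move=> sM pD pZ pC.
pose J y := nrm y ^+ 2 - 2 * p y.
pose E := [set J y | y in M].
have E0 : E !=set0 by exists (J 0); exists 0 => //; exact: subspace0.
have lbE : has_lbound E.
  exists (- C ^+ 2) => _ [y My <-]; rewrite /J.
  have := pC _ My; have := sqr_ge0 (nrm y - C); rewrite sqrrB; lra.
have hiE : has_inf E by [].
pose m := inf E.
have mJ y : M y -> m <= J y by move=> My; apply: ge_inf => //; exists y.
have minseq n : exists y, M y /\ J y < m + n.+1%:R^-1.
  have n0 : 0 < n.+1%:R^-1 :> R by rewrite invr_gt0.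
  have [_ [y My <-] Jy] := inf_adherent n0 hiE.
  by exists y; split.
have [u uP] := choice minseq.
have Mu n : M (u n) by case: (uP n).
have Ju n : J (u n) < m + n.+1%:R^-1 by case: (uP n).
have cauchy n k : nrm (u n - u k) ^+ 2 <= 2 * (n.+1%:R^-1 + k.+1%:R^-1).
  have Mh : M ((2^-1 : R)%:C *: (u n + u k)) by apply: subspaceZ => //; exact: subspaceD.
  have := mJ _ Mh; have := Ju n; have := Ju k.
  rewrite /J pZ ?pD //; last exact: subspaceD.
  rewrite -!(rdotff dotH) rdotZl rdotZr rdotBl !rdotBr !rdotDl !rdotDr.
  rewrite (rdotC _ (u k) (u n)); move: n.+1%:R^-1 k.+1%:R^-1 => ? ?; lra.
have cu : cvg (u @ \oo).
  apply/cauchy_cvgP/cauchy_exP => e e0.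
  have eE : e = (complex.Re e)%:C by rewrite RRe_real // gtr0_real.
  rewrite eE ltcR in e0; set r := complex.Re e in eE e0.
  have r20 : 0 < r ^+ 2 / 4 by rewrite divr_gt0 ?exprn_gt0.
  have [N _ hN] := near_infty_natSinv_lt (PosNum r20).
  exists (u N); exists N => // n /= Nn; rewrite -ball_normE /= eE nrmE ltcR.
  rewrite -(@ltr_pXn2r _ 2) ?nnegrE ?nrm_ge0 ?(ltW e0) //.
  apply: (le_lt_trans (cauchy _ _)).
  have := hN _ Nn; have := hN _ (leqnn N); rewrite /=; move: n.+1%:R^-1 N.+1%:R^-1 => ? ?; lra.
move: cu => /cvg_ex[z uz].
exists z; first by apply: subspace_cvg uz => //; exact: nearW.
move=> y My; apply/eqP; rewrite -subr_eq0; apply/eqP.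
(* Moving from [u n] to [u n + s y] lowers [J] by less than [1/(n+1)]. In the limit the quadratic in
   [s] is nonnegative, which forces its linear coefficient to vanish. *)
have key s : 0 <= 2 * s * (rdot z y - p y) + s ^+ 2 * nrm y ^+ 2.
  have c1 : (2 * s * (rdot (u n) y - p y) + s ^+ 2 * nrm y ^+ 2) @[n --> \oo] -->
      2 * s * (rdot z y - p y) + s ^+ 2 * nrm y ^+ 2.
    apply: cvgD; last exact: cvg_cst.
    apply: cvgM; first exact: cvg_cst.
    by apply: cvgB; [exact: rdot_cvg|exact: cvg_cst].
  have c2 : (- (n.+1%:R^-1 : R)) @[n --> \oo] --> 0.
    by rewrite -oppr0; apply: cvgN; exact: cvg_harmonic.
  apply: (ler_cvg_to c2 c1); apply: nearW => n.
  have Msy : M (u n + s%:C *: y) by apply: subspaceD => //; exact: subspaceZ.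
  have := mJ _ Msy; have := Ju n.
  rewrite /J pD ?pZ //; last exact: subspaceZ.
  rewrite -!(rdotff dotH) !rdotDl !rdotDr !rdotZl !rdotZr (rdotC _ y (u n)).
  by move: n.+1%:R^-1 => ?; lra.
set d := rdot z y - p y in key *; set c := nrm y ^+ 2 in key.
have c0 : 0 <= c by exact: sqr_ge0.
(* The quadratic is least at [- d / c]; the added 1 allows [c = 0]. *)
have := key (- d / (c + 1)); rewrite -/d.
have c1 : 0 < c + 1 by lra.
have -> : 2 * (- d / (c + 1)) * d + (- d / (c + 1)) ^+ 2 * c =
  - (d ^+ 2 * ((c + 2) / (c + 1) ^+ 2)) by field; rewrite gt_eqF.
rewrite oppr_ge0 pmulr_lle0; last by rewrite divr_gt0 ?exprn_gt0 //; lra.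
move=> d2; have /eqP : d ^+ 2 = 0 by apply/eqP; rewrite eq_le d2 sqr_ge0.
by rewrite sqrf_eq0 => /eqP d0; rewrite -opprB -/d d0 oppr0.
Qed.

(** The projection is the Riesz representer of [rdot f] on [M]. *)
Lemma projection M f : closed_subspace M ->
  exists2 z, M z & forall y, M y -> dot (f - z) y = 0.
Proof.
move=> sM; have [|||z Mz zP] := @riesz M (rdot f) (nrm f) sM.
- by move=> *; exact: rdotDr.
- by move=> *; exact: rdotZr.
- by move=> y _; apply: le_trans (ler_norm _) (ler_rdot dotH _ _).
exists z => //; apply: rdot_subspace => // y My.
by rewrite rdotBl zP // subrr.
Qed.

End ClosedSubspaces.

(** * Antiderivatives of curves *)

Section RealDerivatives.
Context {R : realType}.
Implicit Types (f df : R -> R).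

Lemma mean_value f df (x y : R) : x <= y ->
  (forall t, x <= t <= y -> is_derive t (1 : R) f (df t)) ->
  exists2 c, x <= c <= y & f y - f x = df c * (y - x).
Proof.
move=> xy fdf; have [||c] := @MVT_segment _ f df x y xy.
- by move=> t; rewrite in_itv /= => /andP[/ltW ? /ltW ?]; apply: fdf; apply/andP.
- by apply: derivable_within_continuous => t tI; have [] := fdf t tI.
by rewrite in_itv /= => ? ?; exists c.
Qed.

Lemma derive0_cst f (x y : R) : x <= y ->
  (forall t, x <= t <= y -> is_derive t (1 : R) f 0) -> f y = f x.
Proof.
move=> xy f0; have [c _] := @mean_value f (fun=> 0) x y xy f0.
by rewrite mul0r => /eqP; rewrite subr_eq0 => /eqP.
Qed.

Lemma derive_ge0_ndecr f df (x y : R) : x <= y ->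
  (forall t, x <= t <= y -> is_derive t (1 : R) f (df t)) ->
  (forall t, x <= t <= y -> 0 <= df t) -> f x <= f y.
Proof.
move=> xy fdf df0; have [c cI] := mean_value xy fdf.
by move=> fE; rewrite -subr_ge0 fE mulr_ge0 ?df0 ?subr_ge0.
Qed.

Lemma derive_le f df g dg (x y : R) : x <= y ->
  (forall t, x <= t <= y -> is_derive t (1 : R) f (df t)) ->
  (forall t, x <= t <= y -> is_derive t (1 : R) g (dg t)) ->
  (forall t, x <= t <= y -> df t <= dg t) -> f y - f x <= g y - g x.
Proof.
move=> xy fdf gdg dfdg; suff : (g - f) x <= (g - f) y by rewrite /= !fctE; lra.
apply: (@derive_ge0_ndecr _ (fun t => dg t - df t)) => // t tI.
  by apply: is_deriveB; [exact: gdg|exact: fdf].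
by rewrite subr_ge0 dfdg.
Qed.

Lemma primitive (g : R -> R) (a : R) : continuous g ->
  exists P : R -> R, forall t, a < t -> is_derive t (1 : R) P (g t).
Proof.
move=> cg; exists (fun x => \int[lebesgue_measure]_(t in `[a, x]) g t)%R => t at_.
have ig : lebesgue_measure.-integrable `[a, t + 1] (EFin \o g).
  apply: continuous_compact_integrable; first exact: segment_compact.
  exact: continuous_subspaceT.
have [d e] := @continuous_FTC1_closed _ g a t (t + 1) (ltr_pwDr ltr01 (lexx t)) ig at_ (cg t).
by apply: DeriveDef; [exact: d|rewrite -derive1E].
Qed.

End RealDerivatives.

Section Antiderivative.
Context {R : realType} {H : completeNormedModType R[i]}.
Context (dot : {dot H for Num.conj}) (dotH : hilbert_form dot).
Local Notation rdot := (rdot dot).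

Lemma cont_nrm_bounded (g : R -> H) (a b : R) : continuous g -> a <= b ->
  exists C, forall t, a <= t <= b -> nrm (g t) <= C.
Proof.
move=> cg ab; have [|c _ cP] := @EVT_max _ (fun t => nrm (g t)) a b ab.
  by apply: continuous_subspaceT => t; apply: nrm_cvg; exact: cg.
by exists (nrm (g c)) => t tI; apply: cP; rewrite in_itv.
Qed.

(* The integral of a curve with values in a closed subspace, as the Riesz
   representer of the integrals of its coefficients. Derivatives are taken from
   [-1] on, so that they are two-sided on [0, +oo[. *)
Lemma antiderivative (K : set H) (g : R -> H) : closed_subspace K ->
  continuous g -> (forall t, K (g t)) ->
  exists G : R -> H, [/\ forall t, K (G t), G 0 = 0 & forall y (t : R), K y -> -1 < t ->
    is_derive t (1 : R) (fun s => rdot (G s) y) (rdot (g t) y)].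
Proof.
move=> sK cg Kg.
have crd y : continuous (fun t => rdot (g t) y).
  by move=> t; apply: rdot_cvg => //; exact: cg.
have [P PP] := choice (fun y => primitive (-1) (crd y)).
(* For [t <= -1] the value 0 is a default: it keeps [p t] linear and bounded, so that a representer
   can be chosen for every [t]. *)
pose p (t : R) (y : H) : R := if -1 < t then P y t - P y 0 else 0.
have zero (f : R -> R) (t : R) : -1 < t -> (forall s : R, -1 < s -> is_derive s (1 : R) f 0) ->
    f t = f 0.
  move=> t1 f0; have [t0|t0] := leP 0 t.
    apply: derive0_cst => // s /andP[s0 _]; apply: f0; lra.
  by apply/esym/derive0_cst; [exact: ltW|move=> s /andP[s0 _]; apply: f0; lra].
have /choice[G GP] (t : R) : exists z : H, K z /\ forall y, K y -> p t y = rdot z y.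
  suff : exists C, [/\ forall f g, K f -> K g -> p t (f + g) = p t f + p t g,
      forall (a : R) f, K f -> p t (a%:C *: f) = a * p t f &
      forall f, K f -> p t f <= C * nrm f].
    by move=> [C [h1 h2 h3]]; have [z Kz zP] := riesz dotH sK h1 h2 h3; exists z.
  rewrite /p; case: (ltP (-1) t) => t1; last first.
    by exists 0; split => *; rewrite ?addr0 ?mulr0 ?mul0r.
  have [|C CP] := @cont_nrm_bounded g (-1) (`|t| + 1) cg.
    by have := normr_ge0 t; lra.
  exists (C * `|t|); split.
  - move=> f h Kf Kh; suff : P (f + h) t - (P f t + P h t) = P (f + h) 0 - (P f 0 + P h 0).
      by lra.
    apply: (zero (fun s => P (f + h) s - (P f s + P h s))) => // s s1.
    rewrite -(subrr (rdot (g s) (f + h))) [X in _ - X]rdotDr.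
    by apply: is_deriveB; [exact: PP|apply: is_deriveD; exact: PP].
  - move=> a f Kf; suff : P (a%:C *: f) t - a * P f t = P (a%:C *: f) 0 - a * P f 0.
      by lra.
    apply: (zero (fun s => P (a%:C *: f) s - a * P f s)) => // s s1.
    rewrite -(subrr (rdot (g s) (a%:C *: f))) [X in _ - X]rdotZr.
    by apply: is_deriveB; [exact: PP|apply: is_deriveZ; exact: PP].
  - move=> f Kf; rewrite mulrAC.
    have bound s : -1 <= s <= `|t| + 1 -> `|rdot (g s) f| <= C * nrm f.
      move=> sI; apply: le_trans (ler_rdot dotH _ _) _.
      by rewrite ler_wpM2r ?nrm_ge0 // CP.
    have [t0|t0] := leP 0 t.
      have [s /andP[s0 st]|c /andP[c0 ct] ->] := @mean_value _ (P f) (fun s => rdot (g s) f) 0 t t0.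
        by apply: PP; lra.
      rewrite subr0 (ger0_norm t0) ler_wpM2r //.
      by apply: le_trans (ler_norm _) (bound c _); rewrite ger0_norm //; lra.
    have [s /andP[s0 st]|c /andP[c0 ct]]
      := @mean_value _ (P f) (fun s => rdot (g s) f) t 0 (ltW t0).
      by apply: PP; lra.
    rewrite sub0r => fE; rewrite -opprB fE (ltr0_norm t0) -mulNr.
    rewrite ler_wpM2r ?oppr_ge0 ?(ltW t0) //; apply: le_trans (ler_norm _) _.
    by rewrite normrN bound //; have := normr_ge0 t; lra.
have Gp t y : K y -> -1 < t -> rdot (G t) y = P y t - P y 0.
  by move=> Ky t1; have [_ /(_ y Ky) <-] := GP t; rewrite /p t1.
exists G; split.
- by move=> t; case: (GP t).
- have [KG0 G0] := GP 0; apply: (rdotff_eq0 dotH).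
  by rewrite -G0 // /p subrr if_same.
- move=> y t Ky t1; apply: (@near_eq_is_derive _ _ _ (fun s => P y s - P y 0)).
    near=> s; rewrite Gp //; near: s; exact: lt_nbhsr.
  by rewrite -[X in is_derive _ _ _ X]subr0; apply: is_deriveB; exact: PP.
Unshelve. all: by end_near. Qed.
End Antiderivative.

(** * Generators of isometric semigroups *)

Lemma is_derive_cvg_at_right {R : realType} (f : R -> R) (a l : R) :
  is_derive a (1 : R) f l -> t^-1 * (f (a + t) - f a) @[t --> 0^'+] --> l.
Proof.
move=> fl; have df := @ex_derive _ _ _ _ _ _ _ fl.
apply: cvg_dnbhs_at_right; rewrite -(@derive_val _ _ _ _ _ _ _ fl).
suff -> : (fun t : R => t^-1 * (f (a + t) - f a)) =
    (fun h : R => h^-1 *: (f (h *: (1 : R) + a) - f a)) by exact: df.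
apply/funext => h; rewrite (_ : h *: (1 : R) = h); last exact: mulr1.
by rewrite (addrC h a).
Qed.

Lemma is_derive_mulr {R : realType} (t c : R) :
  is_derive t (1 : R) (fun s => s * c) c.
Proof.
have -> : (fun s : R => s * c) = c *: id by apply/funext => s; rewrite /= mulrC.
rewrite -[X in is_derive _ _ _ X]mulr1; exact: is_deriveZ.
Qed.

Section SemigroupGenerator.
Context {R : realType} {H : completeNormedModType R[i]}.
Context (dot : {dot H for Num.conj}) (dotH : hilbert_form dot).
Context (K : set H) (S : R -> H -> H).
Context (sK : closed_subspace K) (iS : isometric_semigroup dot K S).
Local Notation rdot := (rdot dot).

Lemma isgD t f g : 0 <= t -> K f -> K g -> S t (f + g) = S t f + S t g.
Proof.
by move=> t0 Kf Kg; rewrite -{1}(scale1r f) (isg_linear iS) // scale1r.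
Qed.

Lemma isg0 t : 0 <= t -> S t 0 = 0.
Proof.
move=> t0; have K0 := subspace0 sK; have := isgD t0 K0 K0.
by rewrite addr0 => /eqP; rewrite -subr_eq subrr => /eqP <-.
Qed.

Lemma isgZ t (a : R[i]) f : 0 <= t -> K f -> S t (a *: f) = a *: S t f.
Proof.
move=> t0 Kf; have := isg_linear iS a t0 Kf (subspace0 sK).
by rewrite isg0 // !addr0.
Qed.

Lemma isg_rdot t f g : 0 <= t -> K f -> K g -> rdot (S t f) (S t g) = rdot f g.
Proof. by move=> t0 Kf Kg; rewrite /rdot (isg_isometric iS). Qed.

Lemma isg_nrm t f : 0 <= t -> K f -> nrm (S t f) = nrm f.
Proof.
move=> t0 Kf; apply: (@pexpIrn _ 2) => //; rewrite ?nnegrE ?nrm_ge0 //.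
by rewrite -!(rdotff dotH) isg_rdot.
Qed.

(** Orbits matter only for [s >= 0]; extending them by their value at 0 gives a curve continuous on
    the whole line, as [antiderivative] requires. *)
Lemma isg_orbit_continuous x : K x -> continuous (fun s : R => S (Num.max s 0) x).
Proof.
move=> Kx t; have /subspace_continuousP cS := isg_continuous iS Kx.
have m0 (s : R) : `[0, +oo[%classic (Num.max s 0).
  by rewrite /= in_itv /= andbT le_max lexx orbT.
have cm : {for t, continuous (fun s : R => Num.max s 0)}.
  by apply: continuous_max; [exact: cvg_id|exact: cvg_cst].
have mw : Num.max s 0 @[s --> t] --> within `[0, +oo[%classic (nbhs (Num.max t 0)).
  move=> P /cm cP; apply: (@filterS _ (nbhs t) _ _ _ _ cP) => s h.
  by apply: h; exact: m0.
exact: cvg_comp mw (cS _ (m0 t)).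
Qed.

(** The adjoint of [S t] inside [K], by Riesz. It moves [S t] off an integral that is known only
    through its pairings. *)
Lemma isg_adjoint t y : 0 <= t -> K y ->
  exists2 z, K z & forall x, K x -> rdot (S t x) y = rdot x z.
Proof.
move=> t0 Ky; have [|||z Kz zP] := @riesz _ _ dot dotH K (fun x => rdot (S t x) y) (nrm y) sK.
- by move=> f g Kf Kg; rewrite isgD // rdotDl.
- by move=> a f Kf; rewrite isgZ // rdotZl.
- move=> f Kf; apply: le_trans (ler_norm _) (le_trans (ler_rdot dotH _ _) _).
  by rewrite isg_nrm // mulrC.
by exists z => // x Kx; rewrite zP // rdotC.
Qed.

(** * Integral of an orbit *)

Section Orbit.
Context (x : H) (Kx : K x) (G : R -> H).
Context (KG : forall t, K (G t)) (G0 : G 0 = 0).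
Context (GP : forall y (t : R), K y -> -1 < t ->
  is_derive t (1 : R) (fun s => rdot (G s) y) (rdot (S (Num.max t 0) x) y)).

Let Kg t : K (S (Num.max t 0) x).
Proof. by apply: (isg_stable iS) => //; rewrite le_max lexx orbT. Qed.

(** [S t] passes under the integral [G h] of the orbit over [[0, h]]: paired with any [y] in [K],
    both sides have the same derivative in [h] and agree at [h = 0]. *)
Lemma orbit_integral_shift (t h : R) : 0 <= t -> 0 <= h -> S t (G h) = G (t + h) - G t.
Proof.
move=> t0 h0; apply/eqP; rewrite -subr_eq0; apply/eqP.
have KD : K (S t (G h) - (G (t + h) - G t)).
  by do 2?apply: subspaceB => //; exact: (isg_stable iS).
suff key y : K y -> rdot (S t (G h) - (G (t + h) - G t)) y = 0.
  by apply: (rdotff_eq0 dotH); exact: key.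
move=> Ky; have [z Kz zP] := isg_adjoint t0 Ky.
rewrite !rdotBl zP //.
suff : rdot (G h) z - rdot (G (t + h)) y = rdot (G 0) z - rdot (G (t + 0)) y.
  by rewrite G0 rdot0l addr0; lra.
apply: (@derive0_cst _ (fun u => rdot (G u) z - rdot (G (t + u)) y)) => //.
move=> u /andP[u0 uh].
have -> : 0 = rdot (S (Num.max u 0) x) z - rdot (S (Num.max (t + u) 0) x) y * 1.
  rewrite !max_l ?addr_ge0 // (isg_add iS) // zP ?mulr1 ?subrr //.
  exact: (isg_stable iS).
apply: is_deriveB; first by apply: GP => //; lra.
apply: (@is_derive1_comp _ (fun s => rdot (G s) y) (fun u => t + u)).
  by apply: GP => //; lra.
by rewrite -[X in is_derive _ _ _ X]add0r; apply: is_deriveD.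
Qed.

(** [G] is given only with weak derivatives. Pairing the remainder [y] with itself in the mean value
    theorem gives [|y|^2 <= (e/2) h |y|], hence convergence in norm. *)
Lemma orbit_integral_derive (t : R) : 0 <= t ->
  (h^-1)%:C *: (G (t + h) - G t) @[h --> 0^'+] --> S t x.
Proof.
move=> t0; apply/cvg_nrmP => e e0.
have e20 : 0 < e / 2 by lra.
have /cvg_nrmP /(_ _ e20) := @isg_orbit_continuous _ Kx t.
rewrite max_l // => /nbhs_normP[d /= d0 dP].
near=> h.
have h0 : 0 < h by near: h; exact: nbhs_right_gt.
have hd : h < d by near: h; exact: nbhs_right_lt.
set y := G (t + h) - G t - h%:C *: S t x.
have Ky : K y.
  apply: subspaceB => //; first exact: subspaceB.
  by apply: subspaceZ => //; exact: (isg_stable iS).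
have [||c /andP[tc ch]] := @mean_value _ (fun s => rdot (G s) y - s * rdot (S t x) y)
    (fun s => rdot (S (Num.max s 0) x) y - rdot (S t x) y) t (t + h).
- by rewrite lerDl ltW.
- move=> s /andP[ts _]; apply: is_deriveB; last exact: is_derive_mulr.
  by apply: GP => //; lra.
rewrite -rdotBl => yE.
have {}yE : nrm y ^+ 2 = rdot (S (Num.max c 0) x - S t x) y * h.
  by rewrite -(rdotff dotH) {1}/y !rdotBl rdotZl -rdotBl; move: yE; rewrite !rdotBl; lra.
have cd : nrm (S (Num.max c 0) x - S t x) < e / 2.
  by rewrite nrmC; apply: dP; rewrite /= ltr_norml; apply/andP; split; lra.
have yh : nrm y <= e / 2 * h.
  have [->|y0] := eqVneq (nrm y) 0; first by rewrite mulr_ge0 ?ltW.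
  have {}y0 : 0 < nrm y by rewrite lt_neqAle eq_sym y0 nrm_ge0.
  rewrite -(@ler_pM2r _ (nrm y)) // -expr2 yE mulrAC ler_wpM2r ?(ltW h0) //.
  apply: le_trans (ler_norm _) (le_trans (ler_rdot dotH _ _) _).
  by rewrite ler_wpM2r ?nrm_ge0 ?ltW.
have -> : S t x - (h^-1)%:C *: (G (t + h) - G t) = - ((h^-1)%:C *: y).
  rewrite /y [in RHS]scalerBr scalerA -rmorphM /= mulVf ?gt_eqF //.
  by rewrite scale1r opprB.
rewrite nrmN nrmZr gtr0_norm ?invr_gt0 // mulrC ltr_pdivrMr //.
by apply: le_lt_trans yh _; rewrite ltr_pM2r //; lra.
Unshelve. all: by end_near. Qed.

End Orbit.

Lemma rdotZi f g : rdot ('i%C *: f) g = - rdot f ('i%C *: g).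
Proof.
by rewrite /rdot dotZir linearZl_LR /=; case: (dot f g) => a b /=; ring.
Qed.

(** The integrated form of [d^* f = - f]: for [f] in [K], an eigenvector of every adjoint of [S t],
    with eigenvalue [e^-t]. *)
Definition decaying f := forall t x, 0 <= t -> K x ->
  dot (S t x) f = (expR (- t))%:C * dot x f.

(** The imaginary part is the real identity at [i x], because [S t] commutes with [i] on [K]. *)
Lemma rdot_decaying f : (forall t x, 0 <= t -> K x ->
  rdot (S t x) f = expR (- t) * rdot x f) -> decaying f.
Proof.
move=> fP t x t0 Kx; rewrite !(dotE dot) fP //.
have -> : rdot (S t x) ('i%C *: f) = expR (- t) * rdot x ('i%C *: f).
  apply: oppr_inj; rewrite -mulrN -!rdotZi -isgZ // fP //.
  exact: subspaceZ.
by apply/eqP; rewrite eq_complex /=; apply/andP; split; apply/eqP; ring.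
Qed.

(** The decay law is differentiated at [t = 0] from the right. The real argument is run for [f] and
    for [i f], which decays as well. *)
Lemma decaying_adjoint_graph f : K f -> decaying f ->
  adjoint_graph dot K (generator K S) f (- f).
Proof.
move=> Kf fP; split => //; first exact: subspaceN.
have key g : K g -> decaying g -> forall x y, generator K S x y ->
    rdot y g = - rdot x g.
  move=> Kg gP x y [Kx xy].
  have c1 : (t^-1 * (expR (- (0 + t)) - expR (- 0)) * rdot x g) @[t --> 0^'+] -->
      - rdot x g.
    rewrite -[- rdot x g]mulN1r; apply: cvgM; last exact: cvg_cst.
    apply: (@is_derive_cvg_at_right _ (fun t => expR (- t))).
    have -> : -1 = expR (- 0) * (- 1) :> R by rewrite oppr0 expR0 mul1r.
    exact: (@is_derive1_comp _ expR (fun t => - t)).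
  have c2 : rdot ((t^-1)%:C *: (S t x - x)) g @[t --> 0^'+] --> rdot y g.
    exact: rdot_cvg.
  apply: (cvg_map_unique c2).
  apply: cvg_trans c1; apply: near_eq_cvg; near=> t.
  rewrite rdotZl rdotBl /rdot gP; [|by near: t; exact: nbhs_right_ge|by []].
  by rewrite add0r oppr0 expR0; case: (dot x g) => a b /=; ring.
move=> x y xy; rewrite (dotE dot x) (dotE dot y) scalerN !rdotNr (key f Kf fP x y xy).
have iP : decaying ('i%C *: f).
  by move=> t z t0 Kz; rewrite !dotZir fP //; ring.
by rewrite (key ('i%C *: f) (subspaceZ sK _ Kf) iP x y xy).
Unshelve. all: by end_near. Qed.

Lemma adjoint_graph_decaying f :
  adjoint_graph dot K (generator K S) f (- f) -> K f /\ decaying f.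
Proof.
move=> [Kf _ fP]; split=> //; apply: rdot_decaying => t x t0 Kx.
have [|G [KG G0 GP]] := antiderivative dotH sK (isg_orbit_continuous Kx).
  by move=> s; apply: (isg_stable iS) => //; rewrite le_max lexx orbT.
(* [G u] lies in the domain of the generator with image [S u x - x]: by the shift formula its
   quotients are differences of quotients of [G] at [u] and at 0. *)
have rP u : 0 <= u -> rdot (S u x) f = rdot x f - rdot (G u) f.
  move=> u0; have /fP : generator K S (G u) (S u x - x).
    split => //.
    suff : ((h^-1)%:C *: (G (u + h) - G u) - (h^-1)%:C *: (G (0 + h) - G 0))
        @[h --> 0^'+] --> S u x - S 0 x.
      rewrite (isg_zero iS) //; apply: cvg_trans; apply: near_eq_cvg; near=> h.
      have h0 : 0 <= h by near: h; exact: nbhs_right_ge.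
      rewrite G0 add0r subr0 -scalerBr (orbit_integral_shift Kx KG G0 GP) //.
      by rewrite [h + u]addrC addrAC.
    by apply: cvgB; apply: (orbit_integral_derive Kx KG GP).
  move=> /(congr1 (@complex.Re R)); rewrite -[LHS]/(rdot _ _) -[RHS]/(rdot _ _).
  by rewrite rdotNr rdotBl; lra.
(* By [rP] this function is [e^t (S t x, f)]. Written through [G] it can be differentiated, and [rP]
   again shows that the derivative is zero. *)
suff eE : expR t * (rdot x f - rdot (G t) f) = expR 0 * (rdot x f - rdot (G 0) f).
  have -> : rdot x f = expR t * (rdot x f - rdot (G t) f).
    by rewrite eE G0 rdot0l subr0 expR0 mul1r.
  by rewrite rP // mulrA -expRD addNr expR0 mul1r.
apply: (@derive0_cst _ (fun s => expR s * (rdot x f - rdot (G s) f))) => //.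
move=> s /andP[s0 st].
have -> : 0 = expR s *: (0 - rdot (S (Num.max s 0) x) f) +
    (rdot x f - rdot (G s) f) *: expR s.
  by rewrite max_l // rP // /GRing.scale /=; ring.
apply: is_deriveM.
by apply: is_deriveB; apply: GP => //; lra.
Unshelve. all: by end_near. Qed.

End SemigroupGenerator.

(** * Past and future of a process *)

Section Process.
Context {R : realType} {H : completeNormedModType R[i]}.
Context (dot : {dot H for Num.conj}) (dotH : hilbert_form dot).
Local Notation rdot := (rdot dot).

Lemma dot0C f g : dot f g = 0 -> dot g f = 0.
Proof. by rewrite (dot_conj dot g f) => ->; rewrite conjC0. Qed.

Lemma dot_eq0 f : dot f f = 0 -> f = 0.
Proof. by move=> ff; apply: (rdotff_eq0 dotH); rewrite /rdot ff. Qed.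

Section Unitary.
Context (A : {linear H -> H}) (uA : unitary dot A).

Lemma unitary_dot f g : dot (A f) (A g) = dot f g.
Proof. by case: uA => iA _; exact: iA. Qed.

Lemma unitary_nrm f : nrm (A f) = nrm f.
Proof.
apply: (@pexpIrn _ 2) => //; rewrite ?nnegrE ?nrm_ge0 //.
by rewrite -!(rdotff dotH) /rdot unitary_dot.
Qed.

Lemma unitary_inj f g : A f = A g -> f = g.
Proof.
move=> fg; apply/eqP; rewrite -subr_eq0 -nrm_eq0 -unitary_nrm.
by rewrite (raddfB A) /= fg subrr nrm0.
Qed.

End Unitary.

Context (xi : R -> H) (U : R -> {linear H -> H}).
Context (nc : noncorrelated_increments dot xi) (Ug : unitary_group dot U).
Context (inv : invariant_process xi U) (xi_process : process xi).
Local Notation space := (increments_space xi).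
Local Notation past := (past xi).
Local Notation future := (future xi).

Lemma U_unitary t : unitary dot (U t). Proof. by case: Ug. Qed.

Lemma U0 f : U 0 f = f. Proof. by case: Ug. Qed.

Lemma UD s t f : U (s + t) f = U s (U t f). Proof. by case: Ug. Qed.

Lemma UK t f : U (- t) (U t f) = f. Proof. by rewrite -UD addNr U0. Qed.

Lemma UNK t f : U t (U (- t) f) = f. Proof. by rewrite -UD subrr U0. Qed.

Lemma U_dotr t f g : dot (U t f) g = dot f (U (- t) g).
Proof. by rewrite -(unitary_dot (U_unitary (- t)) (U t f)) UK. Qed.

Lemma U_adjoint t f : adjoint dot (U t) f = U (- t) f.
Proof.
rewrite /adjoint; case: xgetP => [z _ zP|nz].
  apply/eqP; rewrite -subr_eq0; apply/eqP/dot_eq0.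
  by rewrite dotBr -zP U_dotr subrr.
by exfalso; apply: (nz (U (- t) f)) => x; exact: U_dotr.
Qed.

Lemma U_xi t s : U t (xi s) = xi (t + s) - xi t.
Proof. by rewrite inv addrC addKr. Qed.

Lemma U_increment t s r : U t (xi s - xi r) = xi (t + s) - xi (t + r).
Proof. by rewrite raddfB /= !U_xi opprB addrA subrK. Qed.

Lemma xi0 : xi 0 = 0. Proof. by case: xi_process. Qed.

Lemma past_subspace t : closed_subspace (past t).
Proof. exact: closed_span_subspace. Qed.

Lemma future_subspace t : closed_subspace (future t).
Proof. exact: closed_span_subspace. Qed.

Lemma space_subspace : closed_subspace space.
Proof. exact: closed_span_subspace. Qed.

Lemma past_increment t s r : s <= t -> r <= t -> past t (xi s - xi r).
Proof.
move=> st rt; apply: sub_closed_span.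
by exists s; rewrite /= ?in_itv //; exists r; rewrite /= ?in_itv.
Qed.

Lemma future_increment t s r : t <= s -> t <= r -> future t (xi s - xi r).
Proof.
move=> st rt; apply: sub_closed_span.
by exists s; rewrite /= ?in_itv ?andbT //; exists r; rewrite /= ?in_itv ?andbT.
Qed.

Lemma space_increment s r : space (xi s - xi r).
Proof. by apply: sub_closed_span; exists s => //; exists r. Qed.

Lemma past_min t M : closed_subspace M ->
  (forall s r, s <= t -> r <= t -> M (xi s - xi r)) -> past t `<=` M.
Proof.
move=> sM MP; apply: closed_span_min => // _ [s /= + [r /= + <-]].
by rewrite !in_itv /= => st rt; exact: MP.
Qed.

Lemma future_min t M : closed_subspace M ->
  (forall s r, t <= s -> t <= r -> M (xi s - xi r)) -> future t `<=` M.
Proof.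
move=> sM MP; apply: closed_span_min => // _ [s /= + [r /= + <-]].
by rewrite !in_itv /= !andbT => st rt; exact: MP.
Qed.

Lemma space_min M : closed_subspace M ->
  (forall s r, M (xi s - xi r)) -> space `<=` M.
Proof. by move=> sM MP; apply: closed_span_min => // _ [s _ [r _ <-]]. Qed.

Lemma past_space t : past t `<=` space.
Proof. by apply: past_min => [|s r _ _]; [exact: space_subspace|exact: space_increment]. Qed.

Lemma future_space t : future t `<=` space.
Proof. by apply: future_min => [|s r _ _]; [exact: space_subspace|exact: space_increment]. Qed.

Lemma past_le s t : s <= t -> past s `<=` past t.
Proof.
move=> st; apply: past_min => [|r q rs qs]; first exact: past_subspace.
by apply: past_increment; exact: le_trans st.
Qed.

Lemma U_past t r f : past r f -> past (t + r) (U t f).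
Proof.
apply: (@past_min r (U t @^-1` past (t + r))).
  by apply: preimage_subspace; [exact: unitary_nrm (U_unitary t)|exact: past_subspace].
by move=> s q sr qr; rewrite /= U_increment; apply: past_increment; rewrite lerD2l.
Qed.

Lemma U_future t r f : future r f -> future (t + r) (U t f).
Proof.
apply: (@future_min r (U t @^-1` future (t + r))).
  by apply: preimage_subspace; [exact: unitary_nrm (U_unitary t)|exact: future_subspace].
by move=> s q sr qr; rewrite /= U_increment; apply: future_increment; rewrite lerD2l.
Qed.

Lemma U_space t f : space f -> space (U t f).
Proof.
apply: (@space_min (U t @^-1` space)).
  by apply: preimage_subspace; [exact: unitary_nrm (U_unitary t)|exact: space_subspace].
by move=> s q; rewrite /= U_increment; exact: space_increment.
Qed.

Lemma orthogonal1_subspace (g : H) : closed_subspace [set f | dot f g = 0].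
Proof.
have -> : [set f | dot f g = 0] = [set f | forall h, [set g] h -> dot f h = 0].
  by apply/seteqP; split=> f /= => [fg h ->|]; [|apply].
exact: orthogonal_subspace.
Qed.

Lemma increments_orthogonal t s r s' r' : s <= t -> r <= t -> t <= s' -> t <= r' ->
  dot (xi s - xi r) (xi s' - xi r') = 0.
Proof.
have lt_case a b c d : a < b -> b <= t -> t <= c -> c < d ->
    dot (xi b - xi a) (xi d - xi c) = 0.
  move=> ab bt tc cd; apply: nc => //; apply/seteqP; split => // x [] /=.
  by rewrite !in_itv /= => /andP[_ xb] /andP[cx _]; lra.
move=> st rt ts tr; have [rs|sr|->] := ltgtP r s; last by rewrite subrr dot0l.
  have [rs'|sr'|->] := ltgtP r' s'; last by rewrite subrr dot0r.
    exact: lt_case.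
  by rewrite -(opprB (xi r')) dotNr lt_case // oppr0.
rewrite -(opprB (xi r)) dotNl.
have [rs'|sr'|->] := ltgtP r' s'; last by rewrite subrr dot0r oppr0.
  by rewrite lt_case // oppr0.
by rewrite -(opprB (xi r')) dotNr lt_case // !oppr0.
Qed.

Lemma past_future_orthogonal t f g : past t f -> future t g -> dot f g = 0.
Proof.
move=> pf fg; apply: (past_min (orthogonal1_subspace g) _ pf) => s r st rt.
apply: dot0C; apply: (future_min (orthogonal1_subspace _) _ fg) => s' r' st' rt'.
by apply: dot0C; exact: (@increments_orthogonal t).
Qed.

Lemma orthogonal_space f : space f -> (forall s r, dot (xi s - xi r) f = 0) -> f = 0.
Proof.
by move=> sf fP; apply: dot_eq0; exact: (space_min (orthogonal1_subspace f) fP sf).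
Qed.

Lemma past_orthogonal f : past 0 f -> (forall s, 0 <= s -> dot (xi (- s)) f = 0) ->
  f = 0.
Proof.
move=> pf fP; apply: dot_eq0; apply: (past_min (orthogonal1_subspace f) _ pf).
move=> s r s0 r0; rewrite /= dotBl -[s]opprK -[r]opprK !fP ?subrr ?oppr_ge0 //.
Qed.

(** Past and future of [t] together generate all increments, since [xi s - xi r] can be taken
    through [xi t]. The part of [f] off the past is orthogonal to both, hence zero. *)
Lemma orthogonal_future_past t f : space f -> (forall g, future t g -> dot f g = 0) ->
  past t f.
Proof.
move=> sf fP; have [z pz zP] := projection dotH f (past_subspace t).
suff : f - z = 0 by move/eqP; rewrite subr_eq0 => /eqP ->.
apply: orthogonal_space => [|s r].
  by apply: (subspaceB space_subspace) => //; exact: past_space pz.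
have half q : dot (xi q - xi t) (f - z) = 0.
  apply: dot0C; have [qt|tq] := leP q t; first by apply: zP; exact: past_increment.
  have fq : future t (xi q - xi t) by apply: future_increment => //; exact: ltW.
  by rewrite dotBl fP // (past_future_orthogonal pz fq) subrr.
have -> : xi s - xi r = (xi s - xi t) - (xi r - xi t) by rewrite opprB addrA subrK.
by rewrite dotBl !half subrr.
Qed.

(** Every increment lies in the future of some [- t] with [t >= 0], and that future is orthogonal to
    the past of [- t]. *)
Lemma remote_past f : (forall t, 0 <= t -> past (- t) f) -> f = 0.
Proof.
move=> fP; apply: orthogonal_space => [|s r].
  by apply: (@past_space (- 0)); exact: fP.
apply: dot0C; apply: (@past_future_orthogonal (- (`|s| + `|r|))).
  by apply: fP; rewrite addr_ge0.
have := lerNnormlW (lexx `|s|); have := lerNnormlW (lexx `|r|).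
have := normr_ge0 s; have := normr_ge0 r.
by move=> ? ? ? ?; apply: future_increment; lra.
Qed.

End Process.

(** * Markovian cocycles *)

Section Cocycle.
Context {R : realType} {H : completeNormedModType R[i]}.
Context (dot : {dot H for Num.conj}) (dotH : hilbert_form dot).
Context (xi : R -> H) (U W : R -> {linear H -> H}).
Context (nc : noncorrelated_increments dot xi) (Ug : unitary_group dot U).
Context (inv : invariant_process xi U) (xi_process : process xi).
Context (Wc : cocycle dot U W) (Wm : markovian xi W).
Context (Ws : forall t f, increments_space xi f -> increments_space xi (W t f)).
Local Notation rdot := (rdot dot).
Local Notation space := (increments_space xi).
Local Notation past := (past xi).
Local Notation future := (future xi).
Local Notation Winf := (minus_infinity_limit W).
Local Notation K := (past 0).
Local Notation V := (fun (t : R) (f : H) => U (- t) f).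
Local Notation tV := (fun (t : R) (f : H) => W (- t) (U (- t) f)).

Lemma W_unitary t : unitary dot (W t). Proof. by case: Wc. Qed.

Lemma W0 f : W 0 f = f. Proof. by case: Wc. Qed.

Lemma WD t s f : W (t + s) f = W t (U t (W s (U (- t) f))).
Proof. by case: Wc => _ _ _ ->; rewrite (U_adjoint dotH Ug). Qed.

Lemma W_dot t f g : dot (W t f) (W t g) = dot f g.
Proof. exact: (unitary_dot (W_unitary t) f g). Qed.

Lemma W_nrm t f : nrm (W t f) = nrm f.
Proof. exact: (unitary_nrm dotH (W_unitary t) f). Qed.

Lemma WNK t f : W (- t) (U (- t) (W t (U t f))) = f.
Proof. by have := WD (- t) t f; rewrite opprK addNr W0 => <-. Qed.

(** The Markov property concerns [W t] on the future of [t]. The identity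
    [W t U t W (- t) U (- t) = I], applied to [U t f], carries it to [W (- t)] on the future of
    0. *)
Lemma W_future t f : 0 <= t -> future 0 f -> W (- t) f = f.
Proof.
rewrite le_eqVlt => /predU1P[<- _|t0 ff]; first by rewrite oppr0 W0.
have Uf : future t (U t f) by have := U_future dotH Ug inv (t:=t) ff; rewrite addr0.
have := WD t (- t) (U t f); rewrite subrr W0 (UK Ug) -{1}(Wm t0 Uf).
by move=> /(unitary_inj dotH (W_unitary t)) /(unitary_inj dotH (U_unitary Ug t)) <-.
Qed.

(** An isometry fixing the future of 0 pointwise preserves orthogonality to it. By [Ws] the image
    stays in the space of increments, where this orthogonality means lying in the past. *)
Lemma W_past t f : 0 <= t -> K f -> K (W (- t) f).
Proof.
move=> t0 Kf; apply: (orthogonal_future_past dotH nc).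
  by apply: Ws; exact: (past_space Kf).
move=> g fg; rewrite -(W_future t0 fg) W_dot.
exact: (past_future_orthogonal dotH nc Kf fg).
Qed.

(** In [W (- t) = W (- r) U (- r) W (- (t - r)) U r] the factor [U r] moves [f] to the future of 0,
    which the inner [W] fixes. *)
Lemma W_stationary r t f : 0 <= r -> r <= t -> future (- r) f -> W (- t) f = W (- r) f.
Proof.
move=> r0 rt ff; have -> : - t = - r + - (t - r) by lra.
have := U_future dotH Ug inv (t:=r) ff; rewrite subrr => Uff.
by rewrite WD opprK (W_future _ Uff) ?(UK Ug) ?subr_ge0.
Qed.

(** All [W (- t)] are isometric, so convergence passes to closures and need only be checked on
    single increments. *)
Lemma cvg_W_subspace : closed_subspace [set f | cvg (W (- t) f @[t --> +oo])].
Proof.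
split.
- apply: nrm_closed => f fP; apply/cauchy_cvgP/cauchy_exP => e e0.
  have eE : e = (complex.Re e)%:C by rewrite RRe_real // gtr0_real.
  rewrite eE ltcR in e0; set r := complex.Re e in eE e0.
  have r20 : 0 < r / 2 by lra.
  have [g /cvg_ex[x gx] fg] := fP _ r20; exists x.
  have /cvg_nrmP /(_ _ r20) gx' := gx.
  rewrite /fmap /=; near=> t; rewrite /= -ball_normE /= eE nrmE ltcR.
  apply: le_lt_trans (nrm_distD (W (- t) g) _ _) _.
  rewrite (splitr r) ltrD //; first by near: t; exact: gx'.
  by rewrite -raddfB /= W_nrm nrmC.
- rewrite /=; under eq_fun do rewrite raddf0; exact: is_cvg_cst.
- move=> a f g /= cf cg; under eq_fun do rewrite linearP.
  by apply: is_cvgD => //; exact: is_cvgZr.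
Unshelve. all: by end_near. Qed.

Lemma Winf_stationary r f : 0 <= r -> future (- r) f ->
  W (- t) f @[t --> +oo] --> W (- r) f.
Proof.
move=> r0 ff; apply: cvg_near_cst; near=> t.
by apply: W_stationary => //; near: t; exact: nbhs_pinfty_ge.
Unshelve. all: by end_near. Qed.

Lemma Winf_cvg f : space f -> W (- t) f @[t --> +oo] --> Winf f.
Proof.
move=> sf; suff : cvg (W (- t) f @[t --> +oo]) by [].
apply: (space_min cvg_W_subspace _ sf) => s r /=; apply/cvg_ex.
exists (W (- (`|s| + `|r|)) (xi s - xi r)); apply: Winf_stationary.
  by rewrite addr_ge0.
have := lerNnormlW (lexx `|s|); have := lerNnormlW (lexx `|r|).
have := normr_ge0 s; have := normr_ge0 r.
by move=> ? ? ? ?; apply: future_increment; lra.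
Qed.

Lemma Winf_future r f : 0 <= r -> future (- r) f -> Winf f = W (- r) f.
Proof.
move=> r0 ff; have c1 := Winf_cvg (future_space ff).
exact: (cvg_map_unique c1 (Winf_stationary r0 ff)).
Qed.

Lemma Winf_linear (a : R[i]) f g : space f -> space g ->
  Winf (a *: f + g) = a *: Winf f + Winf g.
Proof.
move=> sf sg; have c1 := Winf_cvg (subspaceP (space_subspace xi) a sf sg).
apply: (cvg_map_unique c1); under eq_fun do rewrite linearP.
by apply: cvgD; [apply: cvgZr; exact: Winf_cvg|exact: Winf_cvg].
Qed.

Lemma WinfD f g : space f -> space g -> Winf (f + g) = Winf f + Winf g.
Proof.
by move=> sf sg; rewrite -{1}(scale1r f) Winf_linear // scale1r.
Qed.

Lemma Winf0 : Winf 0 = 0.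
Proof.
have s0 := subspace0 (space_subspace xi); have := WinfD s0 s0.
by rewrite addr0 => /eqP; rewrite -subr_eq subrr => /eqP <-.
Qed.

Lemma WinfZ (a : R[i]) f : space f -> Winf (a *: f) = a *: Winf f.
Proof.
move=> sf; have := Winf_linear a sf (subspace0 (space_subspace xi)).
by rewrite Winf0 !addr0.
Qed.

Lemma WinfB f g : space f -> space g -> Winf (f - g) = Winf f - Winf g.
Proof.
move=> sf sg; rewrite -scaleN1r WinfD ?WinfZ ?scaleN1r //.
exact: (subspaceN (space_subspace xi) sg).
Qed.

Lemma Winf_nrm f : space f -> nrm (Winf f) = nrm f.
Proof.
move=> sf.
have c1 : nrm (W (- t) f) @[t --> +oo] --> nrm (Winf f) by exact: (nrm_cvg (Winf_cvg sf)).
apply: (cvg_map_unique c1); under eq_fun do rewrite W_nrm.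
exact: cvg_cst.
Qed.

Lemma Winf_rdot f g : space f -> space g -> rdot (Winf f) (Winf g) = rdot f g.
Proof.
move=> sf sg; have := nrmB_sqr dotH (Winf f) (Winf g); have := nrmB_sqr dotH f g.
rewrite -WinfB // !Winf_nrm //; first by lra.
exact: (subspaceB (space_subspace xi) sf sg).
Qed.

Lemma Winf_dot f g : space f -> space g -> dot (Winf f) (Winf g) = dot f g.
Proof.
move=> sf sg; rewrite !(dotE dot _ _) -WinfZ // !Winf_rdot // -?(dotE dot) //.
exact: (subspaceZ (space_subspace xi) _ sg).
Qed.

Lemma Winf_past f : K f -> K (Winf f).
Proof.
move=> Kf; apply: (subspace_cvg (past_subspace xi 0) _ (Winf_cvg (past_space Kf))).
by near=> t; apply: W_past => //; near: t; exact: nbhs_pinfty_ge.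
Unshelve. all: by end_near. Qed.

Lemma V_space t f : space f -> space (V t f).
Proof. exact: (U_space dotH Ug inv). Qed.

Lemma V_past t f : 0 <= t -> K f -> K (V t f).
Proof.
move=> t0 Kf; apply: (@past_le _ _ xi (- t + 0)); last exact: (U_past dotH Ug inv).
by rewrite addr0 oppr_le0.
Qed.

Lemma tV_past t f : 0 <= t -> K f -> K (tV t f).
Proof. by move=> t0 Kf; apply: W_past => //; exact: V_past. Qed.

Lemma tV_dot t f g : dot (tV t f) (tV t g) = dot f g.
Proof. by rewrite /= W_dot; exact: (unitary_dot (U_unitary Ug _) f g). Qed.

(** The cocycle identity gives [W (- t) U (- t) W (- s) f = W (- (t + s)) U (- t) f]; both sides
    converge as [s] grows. *)
Lemma tV_Winf t f : space f -> tV t (Winf f) = Winf (V t f).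
Proof.
move=> sf /=; have c1 := Winf_cvg (V_space t sf).
have c2 : W (- t) (U (- t) (W (- s) f)) @[s --> +oo] --> W (- t) (U (- t) (Winf f)).
  have /cvg_nrmP c3 := Winf_cvg sf; apply/cvg_nrmP => e e0; near=> s.
  rewrite -!raddfB /= W_nrm (unitary_nrm dotH (U_unitary Ug _)).
  by near: s; exact: c3.
apply: (cvg_map_unique c2).
have c4 : W (- (t + s)) (U (- t) f) @[s --> +oo] --> Winf (V t f).
  exact: (cvg_comp _ _ (cvg_addrl t) c1).
apply: cvg_trans c4; apply: near_eq_cvg; apply: nearW => s.
by rewrite opprD WD opprK (UNK Ug).
Unshelve. all: by end_near. Qed.

Lemma V_semigroup : isometric_semigroup dot K V.
Proof.
have [_ _ _ Ucont] := Ug.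
split.
- exact: V_past.
- by move=> t a f g _ _ _; rewrite linearP.
- by move=> t f g _ _ _; exact: (unitary_dot (U_unitary Ug _) f g).
- by move=> f _; rewrite /= oppr0 (U0 Ug).
- by move=> s t f _ _ _; rewrite /= opprD (UD Ug).
- move=> f _; apply: continuous_subspaceT => t.
  apply: (@continuous_comp _ _ _ (fun t : R => - t) (fun s => U s f)).
    exact: opp_continuous.
  exact: Ucont.
Qed.

Lemma tV_semigroup : isometric_semigroup dot K tV.
Proof.
have [_ _ _ Ucont] := Ug; have [_ Wcont _ _] := Wc.
split.
- exact: tV_past.
- by move=> t a f g _ _ _; rewrite !linearP.
- by move=> t f g _ _ _; exact: tV_dot.
- by move=> f _; rewrite /= oppr0 (U0 Ug) W0.
- by move=> s t f _ _ _; rewrite /= opprD WD opprK (UD Ug) (UNK Ug).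
- move=> f _; apply: continuous_subspaceT => t.
  have cV : U (- s) f @[s --> t] --> U (- t) f.
    apply: (@continuous_comp _ _ _ (fun t : R => - t) (fun s => U s f)).
      exact: opp_continuous.
    exact: Ucont.
  have cW : W (- s) (U (- t) f) @[s --> t] --> W (- t) (U (- t) f).
    apply: (@continuous_comp _ _ _ (fun t : R => - t) (fun s => W s (U (- t) f))).
      exact: opp_continuous.
    exact: Wcont.
  (* Isometry of [W (- s)] combines the two strong continuities into that of the product. *)
  apply/cvg_nrmP => e e0; have e20 : 0 < e / 2 by lra.
  move/cvg_nrmP/(_ _ e20) : cV => cV; move/cvg_nrmP/(_ _ e20) : cW => cW.
  near=> s; apply: le_lt_trans (nrm_distD (W (- s) (U (- t) f)) _ _) _.
  rewrite (splitr e) ltrD //; first by near: s; exact: cW.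
  by rewrite -raddfB /= W_nrm; near: s; exact: cV.
Unshelve. all: by end_near. Qed.

(** [k] is the adjoint of [Winf] on [K], applied to [y]. As [Winf] is isometric, [Winf k] is the
    projection of [y] onto [Winf K], obtained before this image is known to be closed. *)
Lemma Winf_adjoint y : exists2 k, K k & forall x, K x ->
  dot (y - Winf k) (Winf x) = 0 /\ dot y (Winf x) = dot k x.
Proof.
have sx x : K x -> space x by exact: past_space.
have [|||k Kk kP] := @riesz _ _ dot dotH K (fun x => rdot y (Winf x)) (nrm y) (past_subspace xi 0).
- by move=> f g Kf Kg; rewrite WinfD ?rdotDr //; exact: sx.
- by move=> a f Kf; rewrite WinfZ ?rdotZr //; exact: sx.
- move=> f Kf; apply: le_trans (ler_norm _) (le_trans (ler_rdot dotH _ _) _).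
  by rewrite Winf_nrm //; exact: sx.
exists k => // x Kx.
have ykx : dot y (Winf x) = dot k x.
  rewrite (dotE dot y) (dotE dot k) -WinfZ ?kP //; last exact: sx.
  exact: (subspaceZ (past_subspace xi 0) _ Kx).
by rewrite dotBl Winf_dot ?ykx ?subrr //; exact: sx.
Qed.

(** The adjoint image [k] of [g] is orthogonal to every [xi (- s)] with [s >= 0]; these generate the
    past of 0, so [k = 0]. *)
Lemma orthogonal_Winf g : (forall s, 0 <= s -> dot g (Winf (xi (- s))) = 0) ->
  forall x, K x -> dot g (Winf x) = 0.
Proof.
move=> gP; have [k Kk kP] := Winf_adjoint g.
have xiK s : 0 <= s -> K (xi (- s)).
  by move=> s0; rewrite -(subr0 (xi _)) -(xi0 xi_process); apply: past_increment; rewrite ?oppr_le0.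
suff k0 : k = 0 by move=> x Kx; have [_ ->] := kP x Kx; rewrite k0 dot0l.
apply: (past_orthogonal dotH Kk) => s s0; apply: dot0C.
by have [_ <-] := kP _ (xiK _ s0); exact: gP.
Qed.

(** As [xi (- s)] lies in the future of [- t], [Winf] acts on it as [W (- t)]. What remains is its
    orthogonality to [U (- t) k], which lies in the past of [- t]. *)
Lemma tV_range_orthogonal t k s : 0 <= s <= t -> K k -> dot (tV t k) (Winf (xi (- s))) = 0.
Proof.
move=> /andP[s0 st] Kk; have t0 := le_trans s0 st.
have fx : future (- t) (xi (- s)).
  rewrite -(subr0 (xi _)) -(xi0 xi_process); apply: future_increment; lra.
rewrite (Winf_future t0 fx) W_dot; apply: (past_future_orthogonal dotH nc _ fx).
by have := U_past dotH Ug inv (t:=- t) Kk; rewrite addr0.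
Qed.

(** The only candidate is [k = W t U t g]; it is in [K] once [h = U (- t) k] is orthogonal to the
    future of [- t]. This splits at 0: the future of 0 is fixed by [W (- t)] and orthogonal to [g],
    and on [[- t, 0]] the hypothesis applies. *)
Lemma tV_range t g : 0 <= t -> K g ->
  (forall s, 0 <= s <= t -> dot g (Winf (xi (- s))) = 0) ->
  exists2 k, K k & g = tV t k.
Proof.
move=> t0 Kg gP; set k := W t (U t g).
have gE : g = W (- t) (U (- t) k) by rewrite WNK.
have sk : space k by apply: Ws; apply: U_space => //; exact: (past_space Kg).
exists k => //; suff : past (- t) (V t k).
  by move=> /(U_past dotH Ug inv (t:=t)); rewrite (UNK Ug) subrr.
apply: (orthogonal_future_past dotH nc); first exact: V_space.
set h := V t k; have gh : g = W (- t) h by [].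
have h_future f : future 0 f -> dot h f = 0.
  move=> ff; rewrite -(W_dot (- t)) -gh (W_future t0 ff).
  exact: (past_future_orthogonal dotH nc Kg ff).
have h_xi s : - t <= s -> dot h (xi s) = 0.
  move=> ts; have [s0|s0] := leP 0 s.
    by apply: h_future; rewrite -(subr0 (xi s)) -(xi0 xi_process); exact: future_increment.
  have s1 : 0 <= - s by lra.
  have fx : future (- t) (xi s).
    by rewrite -(subr0 (xi _)) -(xi0 xi_process); apply: future_increment; lra.
  rewrite -(W_dot (- t)) -gh -(Winf_future t0 fx) -[s]opprK gP //; apply/andP; split; lra.
move=> f ff; apply: dot0C; apply: (future_min (orthogonal1_subspace dotH h) _ ff).
by move=> s r ts tr; apply: dot0C; rewrite dotBr !h_xi ?subrr.
Qed.

End Cocycle.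

(** * Wold decomposition *)

(** The intersection of [H1] and [L2] reduces [S] to a unitary semigroup inside the completely
    nonunitary part [L2], so it is zero. With [L1] inside [H1] this leaves [L2 = H2]. *)
Lemma wold_unique {R : realType} {H : completeNormedModType R[i]}
    (dot : {dot H for Num.conj}) (dotH : hilbert_form dot) (K : set H)
    (S : R -> H -> H) (H1 H2 L1 L2 : set H) :
  closed_subspace K -> isometric_semigroup dot K S ->
  wold_decomposition dot K S H1 H2 -> wold_decomposition dot K S L1 L2 ->
  L1 `<=` H1 -> L2 = H2.
Proof.
move=> sK iS [[oH KH] rH1 rH2 uH1 cH2] [[oL KL] rL1 rL2 uL1 cL2] LH.
have [sH1 H1K H1S _] := rH1; have [sH2 H2K _ _] := rH2.
have [sL1 L1K L1S _] := rL1; have [sL2 L2K L2S _] := rL2.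
have self0 f : dot f f = 0 -> f = 0 by exact: (dot_eq0 dotH).
(* [S t] maps the [L1] component of [f] into both [L1] and [L2], so isometry makes that component
   zero. *)
have lift t f : 0 <= t -> H1 f -> L2 (S t f) -> L2 f.
  move=> t0 H1f L2Sf.
  have [a L1a [b L2b abE]] : [set f + g | f in L1 & g in L2] f.
    by rewrite -KL; exact: H1K.
  have Sa : S t a = 0.
    apply: self0; apply: oL; first exact: L1S.
    have -> : S t a = S t f - S t b.
      by rewrite -abE (isgD iS) ?addrK //; [exact: L1K|exact: L2K].
    exact: (subspaceB sL2 L2Sf (L2S _ _ t0 L2b)).
  suff a0 : a = 0 by rewrite -abE a0 add0r.
  by apply: self0; rewrite -(isg_isometric iS t0) ?Sa ?dot0l //; exact: L1K.
have K0 : H1 `&` L2 = [set 0].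
  apply: cL2.
    split; [|by move=> f []|by move=> t f t0 [? ?]; split; [exact: H1S|exact: L2S]|].
      case: sH1 => cH1 H10 H1P; case: sL2 => cL2' L20 L2P.
      split; [exact: closedI|by []|].
      by move=> a f g [? ?] [? ?]; split; [exact: H1P|exact: L2P].
    move=> t f t0 [L2f fP]; split; first exact: L2S.
    move=> g [H1g L2g]; have [_ H1E] := uH1 t t0.
    have [g' H1g' gE] : (S t @` H1) g by rewrite H1E.
    rewrite -gE (isg_isometric iS t0) //; [|exact: L2K|exact: H1K].
    by apply: fP; split => //; apply: (lift t) => //; rewrite gE.
  move=> t t0; split=> [f g [H1f _] [H1g _]|].
    by rewrite (isg_isometric iS t0) //; exact: H1K.
  have [_ H1E] := uH1 t t0; apply/seteqP; split=> [_ [f [? ?] <-]|g [H1g L2g]].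
    by split; [exact: H1S|exact: L2S].
  have [g' H1g' gE] : (S t @` H1) g by rewrite H1E.
  by exists g' => //; split => //; apply: (lift t) => //; rewrite gE.
have H2L2 f : H2 f -> L2 f.
  move=> H2f; have [a L1a [b L2b abE]] : [set f + g | f in L1 & g in L2] f.
    by rewrite -KL; exact: H2K.
  suff a0 : a = 0 by rewrite -abE a0 add0r.
  apply: self0; have := oH a f (LH _ L1a) H2f.
  by rewrite -abE dotDr (oL a b) // addr0.
apply/seteqP; split => // f L2f.
have [a H1a [b H2b abE]] : [set f + g | f in H1 & g in H2] f.
  by rewrite -KH; exact: L2K.
suff a0 : a = 0 by rewrite -abE a0 add0r.
suff : (H1 `&` L2) a by rewrite K0.
split => //; have -> : a = f - b by rewrite -abE addrK.
exact: (subspaceB sL2 L2f (H2L2 _ H2b)).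
Qed.

Section Wold.
Context {R : realType} {H : completeNormedModType R[i]}.
Context (dot : {dot H for Num.conj}) (dotH : hilbert_form dot).
Context (xi : R -> H) (U W : R -> {linear H -> H}).
Context (nc : noncorrelated_increments dot xi) (Ug : unitary_group dot U).
Context (inv : invariant_process xi U) (xi_process : process xi).
Context (Wc : cocycle dot U W) (Wm : markovian xi W).
Context (Ws : forall t f, increments_space xi f -> increments_space xi (W t f)).
Local Notation space := (increments_space xi).
Local Notation past := (past xi).
Local Notation Winf := (minus_infinity_limit W).
Local Notation K := (past 0).
Local Notation V := (fun (t : R) (f : H) => U (- t) f).
Local Notation tV := (fun (t : R) (f : H) => W (- t) (U (- t) f)).
Local Notation H2 := (Winf @` K).
Local Notation H1 := (ocompl dot K H2).

Let sp f : K f -> space f. Proof. exact: past_space. Qed.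

Let VK t f : 0 <= t -> K f -> K (V t f).
Proof. exact: (V_past dotH Ug inv). Qed.

Let WK f : K f -> K (Winf f).
Proof. exact: (Winf_past dotH nc Ug inv Wc Wm Ws). Qed.

Let tVK t f : 0 <= t -> K f -> K (tV t f).
Proof. exact: (tV_past dotH nc Ug inv Wc Wm Ws). Qed.

Let tVW t f : K f -> tV t (Winf f) = Winf (V t f).
Proof. by move=> Kf; apply: (tV_Winf dotH Ug inv Wc Wm); exact: sp. Qed.

Let tVdot t f g : dot (tV t f) (tV t g) = dot f g.
Proof. exact: (tV_dot Ug Wc). Qed.

Lemma wold_split y : K y -> exists2 h, H1 h & exists2 k, K k & y = h + Winf k.
Proof.
move=> Ky; have [k Kk kP] := Winf_adjoint dotH Ug inv Wc Wm y.
exists (y - Winf k); last by exists k => //; rewrite subrK.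
split; first by apply: (subspaceB (past_subspace xi 0)) => //; exact: WK.
by move=> _ [x Kx <-]; have [] := kP x Kx.
Qed.

(** Being a double complement makes [H2] closed; the index computation also uses it to recognize
    elements of [Winf K]. *)
Lemma shift_part_ocompl : H2 = ocompl dot K H1.
Proof.
apply/seteqP; split=> [_ [k Kk <-]|f [Kf fP]].
  split; first exact: WK.
  by move=> g [_ gP]; apply: dot0C; apply: gP; exists k.
have [h H1h [k Kk fE]] := wold_split Kf.
suff h0 : h = 0 by exists k => //; rewrite fE h0 add0r.
have hk : dot (Winf k) h = 0.
  by have [_ hP] := H1h; apply: dot0C; apply: hP; exists k.
by apply: (dot_eq0 dotH); have := fP h H1h; rewrite fE dotDl hk addr0.
Qed.

Lemma remote_unitary_part f : K f ->
  (forall t, 0 <= t -> exists2 k, K k & f = tV t k) -> H1 f.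
Proof.
move=> Kf fP; split => // _ [x Kx <-].
apply: (orthogonal_Winf dotH Ug inv xi_process Wc Wm) => // s s0.
have [k Kk ->] := fP s s0.
by apply: (tV_range_orthogonal dotH nc Ug inv xi_process Wc Wm) => //; rewrite s0 lexx.
Qed.

Lemma tV_unitary_part t f : 0 <= t -> H1 f -> H1 (tV t f).
Proof.
move=> t0 [Kf fP]; split; first exact: tVK.
move=> _ [x Kx <-]; apply: (orthogonal_Winf dotH Ug inv xi_process Wc Wm) => // s s0.
have [st|ts] := leP s t.
  by apply: (tV_range_orthogonal dotH nc Ug inv xi_process Wc Wm) => //; rewrite s0.
have xK r : 0 <= r -> K (xi (- r)).
  move=> r0; rewrite -(subr0 (xi _)) -(xi0 xi_process).
  by apply: past_increment; rewrite ?oppr_le0.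
(* The first summand is covered by the orthogonality to the range. [Winf] of the second is [tV t] of
   a vector of [H2], whose pairing with [tV t f] vanishes by isometry. *)
have -> : xi (- s) = xi (- t) + U (- t) (xi (- (s - t))).
  by rewrite -inv; congr xi; lra.
have st0 : 0 <= s - t by rewrite subr_ge0 ltW.
rewrite (WinfD dotH Ug inv Wc Wm); first last.
- by apply: sp; apply: VK => //; exact: xK.
- by apply: sp; exact: xK.
rewrite dotDr -tVW; last exact: xK.
rewrite tVdot fP ?addr0; last by exists (xi (- (s - t))) => //; exact: xK.
by apply: (tV_range_orthogonal dotH nc Ug inv xi_process Wc Wm) => //; rewrite t0 lexx.
Qed.

(** The preimage stays in [H1], because its pairing with [Winf x] equals that of [f] with
    [Winf (V t x)]. *)
Lemma unitary_part_range t f : 0 <= t -> H1 f -> exists2 k, H1 k & f = tV t k.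
Proof.
move=> t0 [Kf fP].
have [s s0|k Kk fE] := tV_range dotH nc Ug inv xi_process Wc Wm Ws t0 Kf.
  apply: fP; exists (xi (- s)) => //; rewrite -(subr0 (xi _)) -(xi0 xi_process).
  by case/andP: s0 => s0 _; apply: past_increment; rewrite ?oppr_le0.
exists k => //; split => // _ [x Kx <-].
rewrite -(tVdot t) -fE tVW //; apply: fP.
by exists (V t x) => //; exact: VK.
Qed.

Lemma wold_exists : wold_decomposition dot K tV H1 H2.
Proof.
have sK := past_subspace xi 0.
have sH1 : closed_subspace H1 by exact: ocompl_subspace.
have sH2 : closed_subspace H2 by rewrite shift_part_ocompl; exact: ocompl_subspace.
have H2K : H2 `<=` K by move=> _ [k Kk <-]; exact: WK.
have H2S t f : 0 <= t -> H2 f -> H2 (tV t f).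
  by move=> t0 [k Kk <-]; exists (V t k); [exact: VK|rewrite tVW].
split.
- split; first by move=> f g [_ fP]; exact: fP.
  apply/seteqP; split=> [y Ky|_ [f [Kf _] [g H2g <-]]].
    have [h H1h [k Kk ->]] := wold_split Ky.
    by exists h => //; exists (Winf k) => //; exists k.
  by apply: (subspaceD sK) => //; exact: H2K.
- split=> //; first by move=> f [].
    by move=> t f t0; exact: tV_unitary_part.
  by move=> t f t0; rewrite -shift_part_ocompl; exact: H2S.
- by split => // t f t0; exact: tV_unitary_part.
- move=> t t0; split; first by move=> *; exact: tVdot.
  apply/seteqP; split=> [_ [f H1f <-]|f H1f]; first exact: tV_unitary_part.
  by have [k H1k ->] := unitary_part_range t0 H1f; exists k.
- move=> L [sL LH2 _ _] uL; apply/seteqP; split=> [f Lf|_ ->]; last exact: (subspace0 sL).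
  suff [_ fP] : H1 f by apply: (dot_eq0 dotH); apply: fP; exact: LH2.
  apply: remote_unitary_part; first exact: (H2K _ (LH2 _ Lf)).
  move=> t t0; have [_ LE] := uL t t0.
  have [k Lk <-] : (tV t @` L) f by rewrite LE.
  by exists k => //; exact: (H2K _ (LH2 _ Lk)).
Qed.

(** The unitary part of any decomposition lies in every range [tV t K], hence in [H1], as
    [wold_unique] requires. *)
Lemma wold_shift_part L1 L2 : wold_decomposition dot K tV L1 L2 -> L2 = H2.
Proof.
move=> wL; have iS := tV_semigroup dotH nc Ug inv Wc Wm Ws.
apply: (wold_unique dotH (past_subspace xi 0) iS wold_exists wL).
have [_ [_ L1K _ _] _ uL _] := wL.
move=> f L1f; apply: remote_unitary_part; first exact: L1K.
move=> t t0; have [_ LE] := uL t t0.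
have [k Lk <-] : (tV t @` L1) f by rewrite LE.
by exists k => //; exact: L1K.
Qed.

(** A subspace on which [V] is unitary lies in the past of every [- t], and the remote past is
    trivial. *)
Lemma V_completely_nonunitary : completely_nonunitary dot K V.
Proof.
move=> L [sL LK _ _] uL; apply/seteqP; split=> [f Lf|_ ->]; last exact: (subspace0 sL).
apply: (remote_past dotH nc) => t t0; have [_ LE] := uL t t0.
have [k Lk <-] : (V t @` L) f by rewrite LE.
by have := U_past dotH Ug inv (t:=- t) (LK _ Lk); rewrite addr0.
Qed.

End Wold.

(** * Index *)

Section Index.
Context {R : realType} {H : completeNormedModType R[i]}.
Context (dot : {dot H for Num.conj}) (dotH : hilbert_form dot).
Context (xi : R -> H) (U : R -> {linear H -> H}).
Context (nc : noncorrelated_increments dot xi) (Ug : unitary_group dot U).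
Context (inv : invariant_process xi U) (xi_process : process xi).
Local Notation rdot := (rdot dot).
Local Notation K := (past xi 0).
Local Notation V := (fun (t : R) (f : H) => U (- t) f).

Lemma xi_past r : r <= 0 -> K (xi r).
Proof.
by move=> r0; rewrite -(subr0 (xi r)) -(xi0 xi_process); exact: past_increment.
Qed.

Lemma xi_future t r : t <= r -> t <= 0 -> future xi t (xi r).
Proof.
by move=> tr t0; rewrite -(subr0 (xi r)) -(xi0 xi_process); exact: future_increment.
Qed.

Lemma xi_shift s t : xi (- (s + t)) = xi (- t) + V t (xi (- s)).
Proof. by rewrite opprD addrC inv. Qed.

Lemma V_past_orthogonal t x r : K x -> - t <= r -> 0 <= t -> dot (V t x) (xi r) = 0.
Proof.
move=> Kx tr t0; apply: (@past_future_orthogonal _ _ _ dotH _ nc (- t)).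
  by have := U_past dotH Ug inv (t:=- t) Kx; rewrite addr0.
by apply: xi_future => //; rewrite oppr_le0.
Qed.

(** [xi (- t)] is [xi (- s)] plus an increment from before [- s], which is orthogonal to
    [xi (- s)]. *)
Lemma rdot_xi s t : 0 <= s -> s <= t -> rdot (xi (- s)) (xi (- t)) = nrm (xi (- s)) ^+ 2.
Proof.
move=> s0 st; have -> : xi (- t) = xi (- s) + V s (xi (- (t - s))).
  by rewrite -xi_shift; congr (xi (- _)); lra.
have sK : K (xi (- (t - s))) by apply: xi_past; lra.
rewrite rdotDr (rdotff dotH) (rdotC _ (xi (- s)) (V _ _)).
by rewrite [X in _ + X](_ : _ = 0) ?addr0 // /rdot V_past_orthogonal.
Qed.

Lemma nrm_xi_le s t : 0 <= s -> s <= t -> nrm (xi (- s)) <= nrm (xi (- t)).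
Proof.
move=> s0 st; have [->|n0] := eqVneq (nrm (xi (- s))) 0; first exact: nrm_ge0.
have {}n0 : 0 < nrm (xi (- s)) by rewrite lt_neqAle eq_sym n0 nrm_ge0.
rewrite -(ler_pM2l n0) -expr2 -(rdot_xi s0 st).
by apply: le_trans (ler_norm _) (ler_rdot dotH _ _).
Qed.

(** Unit steps have equal norm, so growth is at most linear, and [s + 1 <= 2 e^(s/2)]. The exponent
    [s/2] leaves [e^(-s/2)] after multiplication by the weight [e^-s]. *)
Lemma nrm_xi_bound s : 0 <= s -> nrm (xi (- s)) <= 2 * nrm (xi (-1)) * expR (s / 2).
Proof.
move=> s0; set a := nrm (xi (-1)); have a0 : 0 <= a by exact: nrm_ge0.
have natP n : nrm (xi (- n%:R)) <= n%:R * a.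
  elim: n => [|n IH]; first by rewrite oppr0 (xi0 xi_process) nrm0 mul0r.
  rewrite -natr1 xi_shift; apply: le_trans (nrmD _ _) _.
  by rewrite (unitary_nrm dotH (U_unitary Ug _)) mulrDl mul1r addrC lerD2r.
have /andP[n1 n2] := truncn_itv s0.
apply: le_trans (nrm_xi_le s0 (ltW n2)) _; apply: le_trans (natP _) _.
rewrite -mulrA [a * _]mulrC mulrA ler_wpM2r //.
have := expR_ge1Dx (s / 2); rewrite -(natr1 (Num.trunc s)); lra.
Qed.

Lemma decaying_xi f s t : decaying dot K V f -> 0 <= s -> 0 <= t ->
  dot (xi (- (s + t))) f = dot (xi (- t)) f + (expR (- t))%:C * dot (xi (- s)) f.
Proof.
by move=> fP s0 t0; rewrite xi_shift dotDl fP //; apply: xi_past; rewrite oppr_le0.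
Qed.

(* [psi t := dot (xi (- t)) f] satisfies [psi (s + t) = psi t + e^-t psi s];
   exchanging [s] and [t] gives [psi t (1 - e^-s) = psi s (1 - e^-t)]. *)
Lemma decaying_eq0 f : K f -> decaying dot K V f -> dot (xi (-1)) f = 0 -> f = 0.
Proof.
move=> Kf fP f1; apply: (past_orthogonal dotH Kf) => t t0.
have := decaying_xi fP ler01 t0; rewrite [1 + t]addrC.
rewrite (decaying_xi fP t0 ler01) f1 mulr0 addr0 add0r => /eqP.
rewrite -subr_eq0 -{2}[dot _ f]mul1r -mulrBl mulf_eq0 => /orP[|/eqP //].
rewrite eq_complex /= => /andP[/eqP e1 _]; exfalso.
have : expR (-1) < expR 0 :> R by rewrite ltr_expR; lra.
by rewrite expR0; lra.
Qed.

(** By [decaying_eq0] a decaying vector in [K] is determined by its pairing with [xi (-1)]. The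
    factor matches these pairings, conjugated because [dot] is antilinear on the right. *)
Lemma decaying_scale e f : K e -> decaying dot K V e -> e <> 0 ->
  K f -> decaying dot K V f -> exists c, f = c *: e.
Proof.
move=> Ke eP e0 Kf fP; have e1 : dot (xi (-1)) e != 0.
  by apply/eqP => e1; apply: e0; exact: decaying_eq0.
exists (Num.conj (dot (xi (-1)) f / dot (xi (-1)) e)).
set c := Num.conj _; apply/eqP; rewrite -subr_eq0; apply/eqP/decaying_eq0.
- apply: (subspaceB (past_subspace xi 0)) => //.
  exact: (subspaceZ (past_subspace xi 0)).
- by move=> t x t0 Kx; rewrite !dotBr !dotZr fP // eP //; ring.
- by rewrite dotBr dotZr /c conjCK divfK // subrr.
Qed.

(** The integrand [e^-s xi (- s)]; [Num.max] replaces [xi (- s)] by [xi 0] for negative [s], which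
    keeps the curve in the past and continuous on the line. *)
Let weight (s : R) : H := (expR (- s))%:C *: xi (- Num.max s 0).

Let weight_past s : K (weight s).
Proof.
apply: (subspaceZ (past_subspace xi 0)); apply: xi_past.
by rewrite oppr_le0 le_max lexx orbT.
Qed.

Let weight_rdot s y : 0 <= s -> rdot (weight s) y = expR (- s) * rdot (xi (- s)) y.
Proof. by move=> s0; rewrite rdotZl max_l. Qed.

Let weight_continuous : continuous weight.
Proof.
have [cxi _] := xi_process.
move=> s; apply: cvg_scale_real.
  apply: (@continuous_comp _ _ _ (fun s : R => - s) expR); last exact: continuous_expR.
  exact: opp_continuous.
apply: (@continuous_comp _ _ _ (fun s : R => - Num.max s 0) xi); last exact: cxi.
apply: (@continuous_comp _ _ _ (fun s : R => Num.max s 0) (fun s => - s)).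
  by apply: continuous_max; [exact: cvg_id|exact: cvg_cst].
exact: opp_continuous.
Qed.

Let is_derive_exp (c k t : R) :
  is_derive t (1 : R) (fun s => expR (s * c) * k) (k * (expR (t * c) * c)).
Proof.
apply: (@is_derive1_comp _ (fun u => u * k) (fun s => expR (s * c))).
  exact: is_derive_mulr.
apply: (@is_derive1_comp _ expR (fun s => s * c)).
exact: is_derive_mulr.
Qed.

Lemma decaying_exists : (exists t, xi t <> 0) ->
  exists e, [/\ K e, e <> 0 & decaying dot K V e].
Proof.
move=> xi_neq0; have sK := past_subspace xi 0.
have [G [KG G0 GP]] := antiderivative dotH sK weight_continuous weight_past.
set a := nrm (xi (-1)); have a0 : 0 <= a by exact: nrm_ge0.
have weight_nrm s : 0 <= s -> nrm (weight s) <= 2 * a * expR (s * - 2^-1).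
  move=> s0; rewrite nrmZr max_l // ger0_norm ?expR_ge0 //.
  apply: (@le_trans _ _ (expR (- s) * (2 * a * expR (s / 2)))).
    by rewrite ler_wpM2l ?expR_ge0 // nrm_xi_bound.
  rewrite mulrCA -expRD ler_wpM2l ?mulr_ge0 // ler_expR; lra.
(* The pairing of [G] with the difference [d] itself grows no faster than [h], an antiderivative of
   [2 a e^(-s/2) |d|]. *)
have Gtail x y : 0 <= x -> x <= y -> nrm (G y - G x) <= 4 * a * expR (x * - 2^-1).
  move=> x0 xy; set d := G y - G x.
  have [->|d0] := eqVneq (nrm d) 0; first by rewrite !mulr_ge0 ?expR_ge0.
  have {}d0 : 0 < nrm d by rewrite lt_neqAle eq_sym d0 nrm_ge0.
  have Kd : K d by exact: (subspaceB sK).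
  pose h s := expR (s * - 2^-1) * (- (4 * a * nrm d)).
  have bound : rdot (G y) d - rdot (G x) d <= h y - h x.
    apply: (@derive_le _ (fun s => rdot (G s) d) (fun s => rdot (weight s) d) h
      (fun s => - (4 * a * nrm d) * (expR (s * - 2^-1) * - 2^-1))) => //.
    - by move=> s /andP[xs _]; apply: GP => //; lra.
    - by move=> s _; exact: is_derive_exp.
    - move=> s /andP[xs _]; apply: le_trans (ler_norm _) (le_trans (ler_rdot dotH _ _) _).
      have := weight_nrm s (le_trans x0 xs) => ws.
      apply: (@le_trans _ _ (2 * a * expR (s * - 2^-1) * nrm d)).
        by rewrite ler_wpM2r ?nrm_ge0.
      by rewrite le_eqVlt; apply/orP; left; apply/eqP; field.
  rewrite -(ler_pM2r d0) -expr2 -(rdotff dotH) {1}/d rdotBl.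
  apply: (le_trans bound); rewrite /h.
  have := mulr_ge0 (mulr_ge0 a0 (ltW d0)) (expR_ge0 (y * - 2^-1)); lra.
have /cvg_ex[e eG] : cvg (G t @[t --> +oo]).
  apply/cauchy_cvgP/cauchy_exP => eps eps0.
  have epsE : eps = (complex.Re eps)%:C by rewrite RRe_real // gtr0_real.
  rewrite epsE ltcR in eps0; set r := complex.Re eps in epsE eps0.
  (* The tail after [2 x] is at most [4 a e^-x]; the added 1 keeps the divisor positive when
     [a = 0]. *)
  have a4 : 0 < 4 * a + 1 by lra.
  have [x x0 xr] : exists2 x, 0 <= x & expR (- x) < r / (4 * a + 1).
    have r0 : 0 < r / (4 * a + 1) by rewrite divr_gt0.
    near (pinfty_nbhs R) => x; exists x; first by near: x; exact: nbhs_pinfty_ge.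
    rewrite -[expR _]ger0_norm ?expR_ge0 // -normrN -sub0r; near: x.
    by have /cvgrPdist_lt /(_ _ r0) := @cvgr_expR R.
  exists (G (x * 2)); rewrite /fmap /=; near=> y.
  rewrite /= -ball_normE /= epsE nrmE ltcR nrmC.
  apply: le_lt_trans (Gtail (x * 2) y _ _) _; first by lra.
    by near: y; exact: (nbhs_pinfty_ge (num_real _)).
  have -> : x * 2 * - 2^-1 = - x by field.
  move: xr; rewrite ltr_pdivlMr // => xr.
  by apply: le_lt_trans xr; rewrite mulrC ler_wpM2l ?expR_ge0 //; lra.
have Ke : K e by apply: (subspace_cvg sK _ eG); exact: nearW.
exists e; split => //.
- move=> e0.
  have [t0 t00 xit0] : exists2 t : R, 0 < t & xi (- t) <> 0.
    have [t xit] := xi_neq0; have [t0|t0|t0] := ltgtP t 0.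
    - by exists (- t); rewrite ?oppr_gt0 ?opprK.
    - exists t => // xiN; apply: xit; have := inv (- t) t.
      by rewrite subrr (xi0 xi_process) xiN raddf0 addr0.
    - by exfalso; apply: xit; rewrite t0 (xi0 xi_process).
  set v := nrm (xi (- t0)) ^+ 2.
  have v0 : 0 < v.
    by rewrite exprn_gt0 // lt_neqAle nrm_ge0 andbT eq_sym nrm_eq0; apply/eqP.
  pose p s := rdot (G s) (xi (- t0)).
  have Kt0 : K (xi (- t0)) by apply: xi_past; lra.
  have p' (s : R) : 0 <= s -> is_derive s (1 : R) p (expR (- s) * rdot (xi (- s)) (xi (- t0))).
    by move=> s0; rewrite -weight_rdot //; apply: GP => //; lra.
  have p1 : 0 <= p t0.
    have -> : 0 = p 0 by rewrite /p G0 rdot0l.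
    apply: (@derive_ge0_ndecr _ p (fun s => expR (- s) * rdot (xi (- s)) (xi (- t0)))).
    - exact: ltW.
    - by move=> s /andP[s0 _]; exact: p'.
    - by move=> s /andP[s0 st]; rewrite rdot_xi // mulr_ge0 ?expR_ge0 ?sqr_ge0.
  (* [c] is the integral of [v e^-s] over [[t0, t0 + 1]]. Beyond [t0] the derivative of [p] is
     [v e^-s], so [c] bounds [p T] from below uniformly and the limit [e] is not zero. *)
  pose c := v * (expR (- t0) - expR (- (t0 + 1))).
  have c0 : 0 < c by rewrite mulr_gt0 // subr_gt0 ltr_expR; lra.
  have pT T : t0 + 1 <= T -> c <= p T.
    move=> tT; have tT' : t0 <= T by lra.
    have := @derive_le _ (fun s => expR (s * -1) * - v) (fun s => - v * (expR (s * -1) * -1))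
      p (fun s => expR (- s) * rdot (xi (- s)) (xi (- t0))) t0 T tT'.
    rewrite !mulrN1 => bound.
    have : - v * expR (- T) - - v * expR (- t0) <= p T - p t0.
      rewrite ![- v * _]mulrC; apply: bound.
      - by move=> s _; exact: is_derive_exp.
      - by move=> s /andP[ts _]; apply: p'; lra.
      - move=> s /andP[ts _]; rewrite rdotC rdot_xi //; last exact: ltW.
        by rewrite !mulrN1 mulrNN mulrC.
    have : expR (- T) <= expR (- (t0 + 1)) by rewrite ler_expR; lra.
    rewrite -(ler_pM2l v0) /c; lra.
  have : c <= rdot e (xi (- t0)).
    have c1 : p T @[T --> +oo] --> rdot e (xi (- t0)) by exact: rdot_cvg.
    apply: (cvgr_to_ge c1); near=> T; apply: pT; near: T; exact: (nbhs_pinfty_ge (num_real _)).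
  by rewrite e0 rdot0l leNgt c0.
- have iS := V_semigroup dotH Ug inv.
  apply: (rdot_decaying sK iS) => t x t0 Kx; set y := V t x.
  have Ky : K y by exact: (V_past dotH Ug inv).
  (* [y] lies in the past of [- t], so it is orthogonal to the integrand on [[0, t]]. *)
  have Gt : rdot (G t) y = 0.
    rewrite -(rdot0l dot y) -{1}G0.
    apply: (@derive0_cst _ (fun s => rdot (G s) y)) => // s /andP[s0 st].
    have -> : 0 = rdot (weight s) y.
      rewrite weight_rdot // rdotC /rdot V_past_orthogonal ?mulr0 //; lra.
    by apply: GP => //; lra.
  (* [xi (- (u + t))] is [xi (- t)], orthogonal to [y], plus [V t (xi (- u))]; shifting the weight
     yields the factor [e^-t]. *)
  have shift T : 0 <= T -> rdot (G (T + t)) y = expR (- t) * rdot (G T) x.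
    move=> T0; apply/eqP; rewrite -subr_eq0; apply/eqP.
    have -> : 0 = rdot (G (0 + t)) y - rdot (G 0) x * expR (- t).
      by rewrite add0r Gt G0 rdot0l mul0r subrr.
    rewrite [expR _ * _]mulrC.
    apply: (@derive0_cst _ (fun u => rdot (G (u + t)) y - rdot (G u) x * expR (- t)))
      => // u /andP[u0 uT].
    have -> : 0 = rdot (weight (u + t)) y * 1 - expR (- t) * rdot (weight u) x.
      have xiy : rdot (xi (- t)) y = 0.
        by rewrite rdotC /rdot V_past_orthogonal.
      have Vxi : rdot (V t (xi (- u))) y = rdot (xi (- u)) x.
        by rewrite /rdot (unitary_dot (U_unitary Ug _)).
      rewrite !weight_rdot ?addr_ge0 // xi_shift rdotDl xiy Vxi add0r opprD expRD.
      by ring.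
    apply: is_deriveB.
      apply: (@is_derive1_comp _ (fun s => rdot (G s) y) (fun u => u + t)).
        by apply: GP => //; lra.
      by rewrite -[X in is_derive _ _ _ X]addr0; apply: is_deriveD.
    apply: (@is_derive1_comp _ (fun s => s * expR (- t)) (fun s => rdot (G s) x)).
      exact: is_derive_mulr.
    by apply: GP => //; lra.
  rewrite (rdotC _ y) (rdotC _ x).
  have c1 : rdot (G (T + t)) y @[T --> +oo] --> rdot e y.
    by apply: rdot_cvg => //; exact: (cvg_comp _ _ (cvg_addrr t) eG).
  have c2 : expR (- t) * rdot (G T) x @[T --> +oo] --> expR (- t) * rdot e x.
    by apply: cvgM; [exact: cvg_cst|exact: rdot_cvg].
  apply: (cvg_map_unique c1); apply: cvg_trans c2; apply: near_eq_cvg; near=> T.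
  by rewrite shift //; near: T; exact: (nbhs_pinfty_ge (num_real _)).
Unshelve. all: by end_near. Qed.

End Index.

(** * Index of the perturbed semigroup *)

Section PerturbedIndex.
Context {R : realType} {H : completeNormedModType R[i]}.
Context (dot : {dot H for Num.conj}) (dotH : hilbert_form dot).
Context (xi : R -> H) (U W : R -> {linear H -> H}).
Context (nc : noncorrelated_increments dot xi) (Ug : unitary_group dot U).
Context (inv : invariant_process xi U) (xi_process : process xi).
Context (Wc : cocycle dot U W) (Wm : markovian xi W).
Context (Ws : forall t f, increments_space xi f -> increments_space xi (W t f)).
Local Notation Winf := (minus_infinity_limit W).
Local Notation K := (past xi 0).
Local Notation V := (fun (t : R) (f : H) => U (- t) f).
Local Notation tV := (fun (t : R) (f : H) => W (- t) (U (- t) f)).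
Local Notation H1 := (ocompl dot K (Winf @` K)).

Let sp f : K f -> increments_space xi f. Proof. exact: past_space. Qed.

Let VK t f : 0 <= t -> K f -> K (V t f).
Proof. exact: (V_past dotH Ug inv). Qed.

Let tVW t f : K f -> tV t (Winf f) = Winf (V t f).
Proof. by move=> Kf; apply: (tV_Winf dotH Ug inv Wc Wm); exact: sp. Qed.

Let Wdot f g : K f -> K g -> dot (Winf f) (Winf g) = dot f g.
Proof. by move=> Kf Kg; apply: (Winf_dot dotH Ug inv Wc Wm); exact: sp. Qed.

(** A vector [x] of the unitary part equals [tV t k] with [|k| = |x|], so the real part of [(x, f)]
    is at most [e^-t |x| |f|] in modulus, for every [t >= 0]. *)
Lemma decaying_orthogonal f x : decaying dot K tV f -> H1 x -> dot f x = 0.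
Proof.
move=> fP; have sH1 : closed_subspace H1.
  exact: (ocompl_subspace dotH _ (past_subspace xi 0)).
apply: (rdot_subspace sH1) => {x} x H1x; rewrite rdotC.
apply/eqP/negPn/negP => r0; set r := rdot dot x f in r0.
have {}r0 : 0 < `|r| by rewrite normr_gt0.
set C := nrm x * nrm f; have C0 : 0 <= C by rewrite mulr_ge0 ?nrm_ge0.
have bound t : 0 <= t -> `|r| * expR t <= C.
  move=> t0; have [k H1k xk] := unitary_part_range dotH nc Ug inv xi_process Wc Wm Ws t0 H1x.
  have Kk : K k by case: H1k.
  have -> : r = expR (- t) * rdot dot k f.
    rewrite /r xk /rdot fP //; case: (dot k f) => a b /=; ring.
  rewrite normrM ger0_norm ?expR_ge0 // mulrAC -expRD addNr expR0 mul1r.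
  apply: le_trans (ler_rdot dotH _ _) _; rewrite /C xk.
  by rewrite (W_nrm dotH Wc) (unitary_nrm dotH (U_unitary Ug _)).
(* At [t = C / |r|] one has [e^t >= 1 + C / |r|], and the bound would give [|r| + C <= C]. *)
have t0 : 0 <= C / `|r| by rewrite divr_ge0 // ltW.
have := bound _ t0; have := expR_ge1Dx (C / `|r|).
rewrite -(ler_pM2l r0) mulrDr mulr1 mulrCA divff ?gt_eqF // mulr1; lra.
Qed.

(** Orthogonality to [H1] places [f] in [Winf K]; the intertwining relation pulls the decay law back
    to [V]. *)
Lemma decaying_Winf f : K f -> decaying dot K tV f ->
  exists k, [/\ K k, decaying dot K V k & f = Winf k].
Proof.
move=> Kf fP; have : (Winf @` K) f.
  rewrite (shift_part_ocompl dotH nc Ug inv Wc Wm Ws); split => // x H1x.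
  exact: decaying_orthogonal.
move=> [k Kk kf]; exists k; split => // t x t0 Kx.
rewrite -Wdot //; last exact: VK.
rewrite -tVW // kf fP //; last exact: (Winf_past dotH nc Ug inv Wc Wm Ws).
by rewrite -kf Wdot.
Qed.

(** Split [x] along [H1] and [Winf K]: the [H1] part and its image under [tV t] are orthogonal to
    [Winf k], and on the rest [Winf] carries the law over from [V]. *)
Lemma Winf_decaying k : K k -> decaying dot K V k -> decaying dot K tV (Winf k).
Proof.
move=> Kk kP t x t0 Kx.
have [h H1h [y Ky ->]] := wold_split dotH nc Ug inv Wc Wm Ws Kx.
have orth z : H1 z -> dot z (Winf k) = 0 by move=> [_ zP]; apply: zP; exists k.
have -> : tV t (h + Winf y) = tV t h + Winf (V t y) by rewrite -tVW // !raddfD.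
rewrite !dotDl (orth h) // orth ?add0r; last first.
  exact: (tV_unitary_part dotH nc Ug inv xi_process Wc Wm Ws).
by rewrite !Wdot ?kP //; exact: VK.
Qed.

(** [Winf] maps the decaying vectors of [V] in [K] onto those of [tV] isometrically, so the line of
    [e] becomes that of [Winf e]. *)
Lemma tV_index1 : (exists t, xi t <> 0) -> has_index dot K tV 1.
Proof.
move=> xi_neq0; have sK := past_subspace xi 0.
have iS := tV_semigroup dotH nc Ug inv Wc Wm Ws.
have [e [Ke e0 eP]] := decaying_exists dotH nc Ug inv xi_process xi_neq0.
exists (fun=> Winf e); split.
- move=> _; have KW : K (Winf e) by exact: (Winf_past dotH nc Ug inv Wc Wm Ws).
  exact: (decaying_adjoint_graph dotH sK KW (Winf_decaying Ke eP)).
- move=> c; rewrite big_ord1 => /eqP; rewrite scaler_eq0 => /orP[/eqP c0 i|].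
    by rewrite (ord1 i).
  rewrite -nrm_eq0 (Winf_nrm dotH Ug inv Wc Wm) ?nrm_eq0; last exact: sp.
  by move=> /eqP.
- move=> f /(adjoint_graph_decaying dotH sK iS)[Kf fP].
  have [k [Kk kP ->]] := decaying_Winf Kf fP.
  have [c ->] := decaying_scale dotH inv xi_process Ke eP e0 Kk kP.
  exists (fun=> c); rewrite big_ord1 (WinfZ dotH Ug inv Wc Wm) //; exact: sp.
Qed.

End PerturbedIndex.

Theorem proposition2p3 (R : realType) (H : completeNormedModType R[i])
    (dot : {dot H for Num.conj}) (xi : R -> H) (U W : R -> {linear H -> H})
    (dotH : hilbert_form dot)
    (xi_process : process xi)
    (xi_neq0 : exists t, xi t <> 0)
    (xi_stationary : stationary_increments dot xi)
    (xi_noncorrelated : noncorrelated_increments dot xi)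
    (U_group : unitary_group dot U)
    (xi_invariant : invariant_process xi U)
    (W_cocycle : cocycle dot U W)
    (W_markovian : markovian xi W)
    (W_stable : forall t f, increments_space xi f -> increments_space xi (W t f)) :
  let K := past xi 0 in
  let V := fun (t : R) (f : H) => U (- t) f in
  let tV := fun (t : R) (f : H) => W (- t) (V t f) in
  let Winf := minus_infinity_limit W in
  [/\ isometric_semigroup dot K V /\ completely_nonunitary dot K V,
      isometric_semigroup dot K tV,
      has_index dot K tV 1,
      forall f, increments_space xi f -> W (- t) f @[t --> +oo] --> Winf f
    & (exists H1 H2, wold_decomposition dot K tV H1 H2) /\
      forall H1 H2, wold_decomposition dot K tV H1 H2 -> H2 = Winf @` K].
Proof.
move=> K V tV Winf; split.
- split; first exact: V_semigroup.
  exact: (V_completely_nonunitary dotH xi_noncorrelated U_group xi_invariant).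
- exact: tV_semigroup.
- exact: tV_index1.
- exact: (Winf_cvg dotH U_group xi_invariant W_cocycle W_markovian).
- split; last exact: wold_shift_part.
  exists (ocompl dot K (Winf @` K)), (Winf @` K); exact: wold_exists.
Qed.
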